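(* Let $n\geq1$ and $\mathbf{A}=\mathbb{Z}[\frac12][v,v^{-1}]$. Let $\sigma\in S_n$ with $\ell(\sigma)$ even and let $\underline{\sigma}$ be a reduced expression of $\sigma$. Then there exist $f^-_{\underline{\sigma},\nu}\in\mathbf{A}$ ($\nu\in\mathcal{OP}_n$) such that $$R_{\underline{\sigma}}\equiv\sum_{\nu\in\mathcal{OP}_n}f^-_{\underline{\sigma},\nu}\,R_{\underline{w_\nu}}\mod[\mathcal{H}^-_{n,\mathbf{A}},\mathcal{H}^-_{n,\mathbf{A}}]_{\bar0}.$$
   Context: Spin Hecke algebra. Let $v$ be an indeterminate. $\mathcal{H}_n^-$ is the $\mathbb{C}(v^{1/2})$-superalgebra generated by odd elements $R_1,\ldots,R_{n-1}$ subject to $R_i^2=-(v^2+1)$; $R_iR_j=-R_jR_i$ for $|i-j|>1$; $R_iR_{i+1}R_i-R_{i+1}R_iR_{i+1}=(v-1)^2(R_{i+1}-R_i)$. $\mathcal{H}^-_{n,\mathbf{A}}$ is the $\mathbf{A}$-subalgebra generated by $R_1,\ldots,R_{n-1}$. For a reduced expression $\underline\sigma=s_{i_1}s_{i_2}\cdots s_{i_r}$ of $\sigma\in S_n$ ($s_i=(i,i+1)$, $r=\ell(\sigma)$ the Coxeter length), put $R_{\underline\sigma}=R_{i_1}R_{i_2}\cdots R_{i_r}$ (this depends on the reduced expression). Choosing one reduced expression for each $\sigma$, the elements $R_{\underline\sigma}$ form an $\mathbf{A}$-basis of $\mathcal{H}^-_{n,\mathbf{A}}$. For a composition $\gamma=(\gamma_1,\ldots,\gamma_\ell)$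 of $n$ (positive parts), $w_\gamma\in S_n$ is given by the reduced expression $\underline{w_\gamma}=(s_1s_2\cdots s_{\gamma_1-1})(s_{\gamma_1+1}\cdots s_{\gamma_1+\gamma_2-1})\cdots(s_{\gamma_1+\cdots+\gamma_{\ell-1}+1}\cdots s_{n-1})$, and $R_{\underline{w_\gamma}}$ is the product of the $R_i$ in this order. $\mathcal{OP}_n$ is the set of partitions of $n$ with all parts odd. $[\mathcal{H},\mathcal{H}]$ is the span of all ordinary commutators $hh'-h'h$ (not supercommutators), and the subscript $\bar0$ denotes the even part. *)

(* Defs.v *)
From HB Require Import structures.
From mathcomp Require Import all_boot all_order all_algebra all_fingroup.
From mathcomp Require Import generic_quotient ring_quotient.
From mathcomp Require Import boolp reals complex.
From mathcomp.multinomials Require Import monalg.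

Set Implicit Arguments.
Unset Strict Implicit.
Unset Printing Implicit Defensive.

Import GRing.Theory.
Local Open Scope ring_scope.
Local Open Scope quotient_scope.

(** * The symmetric group *)

(* The generators of S_n are indexed from 0: i : 'I_n.-1 stands for the index
   i + 1 of the usual numbering, both for simple transpositions and for the
   generators of the Hecke algebra.  Points of {1, ..., n} are shifted in the
   same way. *)
Section Coxeter.
Variable n : nat.

Lemma ltn_pred_l (i : 'I_n.-1) : (i < n)%N.
Proof. by rewrite (leq_trans (ltn_ord i)) ?leq_pred. Qed.

Lemma ltn_pred_r (i : 'I_n.-1) : (i.+1 < n)%N.
Proof. by rewrite -ltn_predRL. Qed.

Definition simple_transp (i : 'I_n.-1) : 'S_n :=
  tperm (Ordinal (ltn_pred_l i)) (Ordinal (ltn_pred_r i)).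

(* In MathComp (s * t) x = t (s x).  Composing in the opposite order exchanges
   s and s^-1, which have the same length, and leaves the notion of reduced
   word unchanged. *)
Definition perm_of_word (w : seq 'I_n.-1) : 'S_n :=
  (\prod_(i <- w) simple_transp i)%g.

Lemma tperm_word d (x y : 'I_n) :
  (y = x + d.+1 :> nat)%N -> exists w, perm_of_word w = tperm x y.
Proof.
elim: d y => [|d IHd] y eq_y.
  have lt_x : (x < n.-1)%N by have := ltn_ord y; rewrite eq_y addn1 ltn_predRL.
  exists [:: Ordinal lt_x]; rewrite /perm_of_word big_seq1; congr tperm; apply: val_inj => //=.
  by rewrite eq_y addn1.
have lt_z : (x + d.+1 < n)%N by apply: ltn_trans (ltn_ord y); rewrite eq_y ltn_add2l.
have [w def_w] := IHd (Ordinal lt_z) erefl.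
have lt_z' : (x + d.+1 < n.-1)%N.
  by have := ltn_ord y; rewrite eq_y addnS ltn_predRL.
pose i := Ordinal lt_z'.
have def_i : simple_transp i = tperm (Ordinal lt_z) y.
  by congr tperm; apply: val_inj => //=; rewrite eq_y !addnS.
exists ([:: i] ++ w ++ [:: i]).
rewrite /perm_of_word !big_cat !big_seq1 /= -/(perm_of_word w) def_w def_i.
rewrite -{1}[tperm (Ordinal _) y]tpermV -/(conjg _ _) tpermJ.
have nxy : x != y by rewrite -val_eqE /= eq_y -{1}[x : nat]addn0 eqn_add2l.
have nxz : x != Ordinal lt_z by rewrite -val_eqE /= -{1}[x : nat]addn0 eqn_add2l.
by rewrite tpermL tpermD // eq_sym.
Qed.

Lemma perm_of_word_surj (s : 'S_n) :
  exists r, [exists t : r.-tuple 'I_n.-1, perm_of_word t == s].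
Proof.
suff [w <-] : exists w, perm_of_word w = s.
  by exists (size w); apply/existsP; exists (in_tuple w).
have [ts -> _] := prod_tpermP s.
elim: ts => [|[x y] ts [w def_w]]; first by exists [::]; rewrite /perm_of_word !big_nil.
suff [w' def_w'] : exists w', perm_of_word w' = tperm x y.
  exists (w' ++ w).
  by rewrite big_cons /= -def_w -def_w' /perm_of_word big_cat.
wlog le_xy : x y / (x <= y)%N => [IH|].
  by have [/IH//|/ltnW/IH] := leqP x y; rewrite tpermC.
move: le_xy; rewrite leq_eqVlt => /orP[/eqP/val_inj ->|lt_xy].
  by exists [::]; rewrite tperm1 /perm_of_word big_nil.
by apply: (@tperm_word (y - x).-1); rewrite prednK ?subn_gt0 // subnKC // ltnW.
Qed.

Definition coxeter_length (s : 'S_n) : nat := ex_minn (perm_of_word_surj s).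

Definition reduced_expression (w : seq 'I_n.-1) (s : 'S_n) : Prop :=
  perm_of_word w = s /\ size w = coxeter_length s.

End Coxeter.

(** * Compositions and odd partitions *)

Fixpoint block_word (k : nat) (g : seq nat) : seq nat :=
  if g is p :: g' then iota k p.-1 ++ block_word (k + p) g' else [::].

(* The reduced expression of w_g, for g a composition of n.  The letters of
   block_word 0 g are nat; pmap insub only retypes them, see
   val_composition_word. *)
Definition composition_word (n : nat) (g : seq nat) : seq 'I_n.-1 :=
  pmap insub (block_word 0 g).

Lemma block_word_lt k g : all (leq 1) g ->
  all (fun i => i < (k + sumn g).-1)%N (block_word k g).
Proof.
elim: g k => //= p g IHg k /andP[p_gt0 g_gt0].
rewrite all_cat addnA IHg // andbT.
case: p p_gt0 => // p _; apply/allP => i; rewrite mem_iota addnS addSn /=.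
by case/andP=> _ lt_i; rewrite (leq_trans lt_i) ?leq_addr.
Qed.

Lemma val_composition_word n g : all (leq 1) g -> sumn g = n ->
  map val (composition_word n g) = block_word 0 g.
Proof.
move=> g_gt0 def_n; rewrite /composition_word.
rewrite (pmap_filter (insubK _)); apply/all_filterP.
by have := block_word_lt 0 g_gt0; rewrite def_n; apply: sub_all => i lt_i; rewrite insubT.
Qed.

(* A partition of n has at most n parts, all at most n, so the partitions of n
   form a subset of the finite type of sequences of length at most n over
   {0, ..., n}. *)
Definition parts n (nu : n.-bseq 'I_n.+1) : seq nat := map val nu.

Definition odd_partitions (n : nat) : {set n.-bseq 'I_n.+1} :=
  [set nu | [&& sorted geq (parts nu), all odd (parts nu) & sumn (parts nu) == n]].

(** * Algebras presented by relations *)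

(* The quotient of F by the two-sided ideal generated by the l - r, for l and r
   related by rel. *)
Section Presented.
Variables (K : fieldType) (F : lalgType K) (rel : F -> F -> Prop).
Implicit Types x y : F.

Inductive rel_ideal : F -> Prop :=
| rel_ideal0 : rel_ideal 0
| rel_idealD x y : rel_ideal x -> rel_ideal y -> rel_ideal (x + y)
| rel_ideal_gen a b l r : rel l r -> rel_ideal (a * (l - r) * b).

Lemma rel_idealMl a x : rel_ideal x -> rel_ideal (a * x).
Proof.
elim=> [|y z _ IHy _ IHz|b c l r lr]; first by rewrite mulr0; apply: rel_ideal0.
  by rewrite mulrDr; apply: rel_idealD.
by rewrite !mulrA; apply: rel_ideal_gen.
Qed.

Lemma rel_idealMr a x : rel_ideal x -> rel_ideal (x * a).
Proof.
elim=> [|y z _ IHy _ IHz|b c l r lr]; first by rewrite mul0r; apply: rel_ideal0.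
  by rewrite mulrDl; apply: rel_idealD.
by rewrite -mulrA; apply: rel_ideal_gen.
Qed.

Definition rel_ideal_pred : {pred F} := fun x => `[< rel_ideal x >].

Lemma rel_idealP x : reflect (rel_ideal x) (x \in rel_ideal_pred).
Proof. exact: asboolP. Qed.

Lemma rel_ideal_zmod_closed : zmod_closed rel_ideal_pred.
Proof.
split=> [|x y /rel_idealP Ix /rel_idealP Iy]; first exact/rel_idealP/rel_ideal0.
by apply/rel_idealP; apply: rel_idealD => //; rewrite -mulN1r; apply: rel_idealMl.
Qed.
HB.instance Definition _ :=
  GRing.isZmodClosed.Build F rel_ideal_pred rel_ideal_zmod_closed.

Definition presented := Quotient.quot (rel_ideal_pred : zmodClosed F).
HB.instance Definition _ := GRing.Zmodule.on presented.

Definition to_pres (x : F) : presented :=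
  \pi_(Quotient.quot (rel_ideal_pred : zmodClosed F)) x.
Definition of_pres (x : presented) : F := repr x.

Lemma of_presK : cancel of_pres to_pres. Proof. exact: reprK. Qed.

Lemma to_pres_eq x y : reflect (rel_ideal (x - y)) (to_pres x == to_pres y).
Proof. by rewrite /to_pres piE Quotient.equivE; apply: rel_idealP. Qed.

Lemma to_presK x : rel_ideal (of_pres (to_pres x) - x).
Proof. by apply/to_pres_eq; rewrite of_presK. Qed.

Lemma to_presD : {morph to_pres : x y / x + y}.
Proof. by move=> x y; rewrite /to_pres piE. Qed.

Definition pres_one : presented := to_pres 1.
Definition pres_mul (x y : presented) : presented :=
  to_pres (of_pres x * of_pres y).
Definition pres_scale (c : K) (x : presented) : presented :=
  to_pres (c *: of_pres x).

Lemma pres_mulE x y : pres_mul (to_pres x) (to_pres y) = to_pres (x * y).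
Proof.
apply/eqP/to_pres_eq; set x' := of_pres _; set y' := of_pres _.
have -> : x' * y' - x * y = (x' - x) * y' + x * (y' - y).
  by rewrite mulrBl mulrBr addrA subrK.
by apply: rel_idealD; [apply: rel_idealMr|apply: rel_idealMl]; apply: to_presK.
Qed.

Lemma pres_scaleE c x : pres_scale c (to_pres x) = to_pres (c *: x).
Proof.
apply/eqP/to_pres_eq; rewrite -scalerBr -[_ - _]mul1r scalerAl.
exact/rel_idealMl/to_presK.
Qed.

Let presE := (pres_mulE, pres_scaleE, to_presD).

Lemma pres_mulA : associative pres_mul.
Proof.
by move=> x y z; rewrite -[x]of_presK -[y]of_presK -[z]of_presK !presE mulrA.
Qed.
Lemma pres_mul1l : left_id pres_one pres_mul.
Proof. by move=> x; rewrite -[x]of_presK presE mul1r. Qed.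
Lemma pres_mul1r : right_id pres_one pres_mul.
Proof. by move=> x; rewrite -[x]of_presK presE mulr1. Qed.
Lemma pres_mulDl : left_distributive pres_mul +%R.
Proof.
move=> x y z; rewrite -[x]of_presK -[y]of_presK -[z]of_presK.
by rewrite -to_presD !pres_mulE mulrDl to_presD.
Qed.
Lemma pres_mulDr : right_distributive pres_mul +%R.
Proof.
move=> x y z; rewrite -[x]of_presK -[y]of_presK -[z]of_presK.
by rewrite -to_presD !pres_mulE mulrDr to_presD.
Qed.
HB.instance Definition _ := GRing.Zmodule_isPzRing.Build presented
  pres_mulA pres_mul1l pres_mul1r pres_mulDl pres_mulDr.

Lemma pres_scaleA a b (x : presented) : pres_scale a (pres_scale b x) = pres_scale (a * b) x.
Proof. by rewrite -[x]of_presK !pres_scaleE scalerA. Qed.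
Lemma pres_scale1 : left_id 1 pres_scale.
Proof. by move=> x; rewrite -[x]of_presK pres_scaleE scale1r. Qed.
Lemma pres_scaleDr : right_distributive pres_scale +%R.
Proof.
move=> a x y; rewrite -[x]of_presK -[y]of_presK.
by rewrite -to_presD !pres_scaleE scalerDr to_presD.
Qed.
Lemma pres_scaleDl (x : presented) : {morph pres_scale^~ x : a b / a + b}.
Proof. by move=> a b; rewrite -[x]of_presK !pres_scaleE scalerDl to_presD. Qed.
HB.instance Definition _ := GRing.Zmodule_isLmodule.Build K presented
  pres_scaleA pres_scale1 pres_scaleDr pres_scaleDl.

Lemma to_presM : {morph to_pres : x y / x * y}.
Proof. by move=> x y; rewrite [RHS]pres_mulE. Qed.
Lemma to_presZ c : {morph to_pres : x / c *: x}.
Proof. by move=> x; rewrite [RHS]pres_scaleE. Qed.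

(* lalgType also requires 1 != 0, which depends on rel. *)
Lemma pres_scalerAl (c : K) (x y : presented) : c *: (x * y) = (c *: x) * y.
Proof.
rewrite -[x]of_presK -[y]of_presK.
by rewrite -to_presM -!to_presZ -to_presM scalerAl.
Qed.

End Presented.

(** * The spin Hecke algebra *)

(* C(v^(1/2)), the variable of the polynomial ring being v^(1/2). *)
Definition base_field (R : realType) : fieldType := {fraction {poly R[i]}}.

Definition vhalf (R : realType) : base_field R := FracField.tofrac 'X.
Definition vv (R : realType) : base_field R := vhalf R ^+ 2.

Inductive subring_gen (T : pzRingType) (S : T -> Prop) : T -> Prop :=
| subring_gen_base x : S x -> subring_gen S x
| subring_gen1 : subring_gen S 1
| subring_genB x y : subring_gen S x -> subring_gen S y -> subring_gen S (x - y)
| subring_genM x y : subring_gen S x -> subring_gen S y -> subring_gen S (x * y).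

(* A = Z[1/2][v, v^-1] *)
Definition in_A (R : realType) : base_field R -> Prop :=
  subring_gen (fun x => [\/ x = 2^-1, x = vv R | x = (vv R)^-1]).

Section SpinHecke.
Variables (R : realType) (n : nat).
Local Notation K := (base_field R).
Local Notation v := (vv R).

Definition free_alg : lalgType K := {malg K[{fmonom 'I_n.-1}]}.

Definition free_gen (i : 'I_n.-1) : free_alg := << fmu i >>.
Local Notation X := free_gen.

Inductive spin_hecke_rel : free_alg -> free_alg -> Prop :=
| rel_square (i : 'I_n.-1) :
    spin_hecke_rel (X i * X i) (- (v ^+ 2 + 1) *: 1)
| rel_far (i j : 'I_n.-1) : (i.+1 < j)%N || (j.+1 < i)%N ->
    spin_hecke_rel (X i * X j) (- (X j * X i))
| rel_braid (i j : 'I_n.-1) : j = i.+1 :> nat ->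
    spin_hecke_rel (X i * X j * X i - X j * X i * X j)
                   ((v - 1) ^+ 2 *: (X j - X i)).

Definition spin_hecke := presented spin_hecke_rel.
HB.instance Definition _ := GRing.PzRing.on spin_hecke.
HB.instance Definition _ := GRing.Lmodule.on spin_hecke.

Definition Rgen (i : 'I_n.-1) : spin_hecke := to_pres spin_hecke_rel (X i).

Definition Rword (w : seq 'I_n.-1) : spin_hecke := \prod_(i <- w) Rgen i.

Inductive spin_hecke_A : spin_hecke -> Prop :=
| spin_hecke_A_gen i : spin_hecke_A (Rgen i)
| spin_hecke_A1 : spin_hecke_A 1
| spin_hecke_AD x y : spin_hecke_A x -> spin_hecke_A y -> spin_hecke_A (x + y)
| spin_hecke_AM x y : spin_hecke_A x -> spin_hecke_A y -> spin_hecke_A (x * y)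
| spin_hecke_AZ a x : in_A a -> spin_hecke_A x -> spin_hecke_A (a *: x).

Inductive span_A (S : spin_hecke -> Prop) : spin_hecke -> Prop :=
| span_A_base x : S x -> span_A S x
| span_A0 : span_A S 0
| span_AD x y : span_A S x -> span_A S y -> span_A S (x + y)
| span_AZ a x : in_A a -> span_A S x -> span_A S (a *: x).

(* The Rgen i are odd. *)
Definition even_part_A : spin_hecke -> Prop :=
  span_A (fun x => exists2 w, ~~ odd (size w) & x = Rword w).

(* Ordinary commutators, not supercommutators. *)
Definition commutator_A : spin_hecke -> Prop :=
  span_A (fun x => exists h h',
    [/\ spin_hecke_A h, spin_hecke_A h' & x = h * h' - h' * h]).

Definition even_commutator_A (x : spin_hecke) : Prop :=
  commutator_A x /\ even_part_A x.

End SpinHecke.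

Arguments Rgen R {n} i.
Arguments Rword R {n} w.

(* Main.v *)
Require Import Defs.
From Stdlib Require Import Ncring Ncring_tac.
From HB Require Import structures.
From mathcomp Require Import all_boot all_order all_algebra all_fingroup.
From mathcomp Require Import reals complex zify.
From mathcomp.multinomials Require Import monalg.

Set Implicit Arguments.
Unset Strict Implicit.
Unset Printing Implicit Defensive.

Import GRing.Theory Num.Theory.
Local Open Scope ring_scope.

(** Write H for the integral spin Hecke algebra over A and call two elements
    congruent when they differ by a sum of commutators and of A-multiples of
    the R_{w_nu}, nu an odd partition.  The claim is that every word of even
    length in the R_i is congruent to 0, by strong induction on its length L.

    The relations change a word of length L only by a sign and by words of
    length L - 2, and a commutator is a cyclic rotation.  So, at length L, words
    may be treated as words of the braid monoid up to rotation, any word with a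
    repeated letter ii being congruent to 0.  The argument for the Coxeter group
    of type A then brings each word to a product of blocks w_g, g a composition
    of n ([all_words]).

    If g has an even part, the corresponding block has odd length and
    anticommutes with the rest of the word; rotating it around the word gives
    x = -x modulo commutators, so 2x = 0, hence x = 0 ([S_even_part]).

    If all the parts of g are odd, it remains to permute them.  In a Hecke
    algebra this is conjugation by an element of the braid group, but the R_i
    are not invertible over A and do not satisfy the braid relations.  Matrices
    over H repair both defects.  Let c_0, c_1, ... be anticommuting matrices with
    entries in A and square -1.  Then
         T_i = (v - 1) (1 + c_i c_{i+1}) + (c_i - c_{i+1}) R_i
    satisfies the braid relations and T_i (T_i - 2 (v - 1)) = 4 v is a unit of A.
    With C = T_0 ... T_{m-2}, the power C^q carries a word with blocks of total
    sizes p, q, p + q = m, to the word with these blocks exchanged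
    ([coxeter_swap_blocks]).  The matrix trace is invariant under conjugation
    modulo commutators, and the trace of the product of the T_i along w_g is
    N R_{w_g}, where N, a power of 2, is the size of the matrices, up to words
    shorter than L ([S_block_trace]).  Thus R_{w_g} and R_{w_g'} are congruent
    to 0 together when g' is a rearrangement of g, and g may be sorted. *)

(** * Hecke generators from spin Hecke and Clifford generators *)

(** Lets [non_commutative_ring] prove identities in every [pzRingType]. *)
Section NcringInstance.
Variable E : pzRingType.

Global Instance pz_ops : @Ncring.Ring_ops E 0 1 +%R *%R (fun x y => x - y) -%R eq := {}.
Global Instance pz_ring : Ncring.Ring (Ro:=pz_ops).
Proof.
split => //; try by (move=> x y -> u w -> //).
- exact: RelationClasses.eq_equivalence.
- by move=> x y ->.
- by move=> x; apply: add0r.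
- by move=> x y; apply: addrC.
- by move=> x y z; apply: addrA.
- by move=> x; apply: mul1r.
- by move=> x; apply: mulr1.
- by move=> x y z; apply: mulrA.
- by move=> x y z; apply: mulrDl.
- by move=> x y z; apply: mulrDr.
- by move=> x; apply: subrr.
Qed.

End NcringInstance.

Section HeckeClifford.
Variable E : pzRingType.

(** When al = v - 1, r is a spin Hecke generator and c1, c2 are Clifford
    generators commuting with r, this is 2 T for a Hecke generator T, that is,
    (T - v) (T + 1) = 0.  The factor 2 keeps halves out of the identities. *)
Definition hecke_clifford (al c1 c2 r : E) : E := al * (1 + c1 * c2) + (c1 - c2) * r.

(** The second component applies [u * w = e] inside a longer monomial, products
    being associated to the left.  Families of such rules normalise monomials. *)
Lemma mulr_rule (u w e : E) : u * w = e -> (u * w = e) * (forall x, x * u * w = x * e).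
Proof. by move=> def_e; split=> // x; rewrite -mulrA def_e. Qed.

Lemma mul_leading_term (p a r t d x : E) : r * d = d * r ->
  (p + a * r) * t - a * d * (r * x) = (p + a * r) * (t - d * x) + p * d * x.
Proof.
move=> rd; have -> : a * d * (r * x) = a * r * d * x by rewrite !mulrA -(mulrA a) -rd !mulrA.
non_commutative_ring.
Qed.

Lemma mul_edge_pair (a b d x : E) : b * b = -1 ->
  (a - b) * ((b - d) * x) = a * b * x - a * d * x + b * d * x + x.
Proof.
move=> bb; have {5}-> : x = - (b * b * x) by rewrite bb mulN1r opprK.
non_commutative_ring.
Qed.

Section Pair.
Variables (al c1 c2 r s : E).
Hypotheses (alC : forall x, x * al = al * x) (rc1 : r * c1 = c1 * r) (rc2 : r * c2 = c2 * r).
Hypotheses (c11 : c1 * c1 = -1) (c22 : c2 * c2 = -1) (c21 : c2 * c1 = - (c1 * c2)).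
Hypotheses (rr : r * r = - s).

(** The cross terms cancel because c1 * c2 anticommutes with c1 - c2.  For
    al = v - 1 and s = v ^+ 2 + 1 the right-hand side is 4 v. *)
Lemma hecke_clifford_quadratic :
  hecke_clifford al c1 c2 r * (hecke_clifford al c1 c2 r - (al + al))
  = (s + s) - (al * al + al * al).
Proof.
have rules := (mulr_rule (alC c1), mulr_rule (alC c2), mulr_rule (alC r),
  mulr_rule rc1, mulr_rule rc2, mulr_rule c11, mulr_rule c22, mulr_rule c21, mulr_rule rr).
rewrite /hecke_clifford.
rewrite !(mulrDl, mulrDr, mulrBl, mulrBr, mulNr, mulrN, mulr1, mul1r, mulrA).
do !rewrite ?rules !(mulrA, mulNr, mulrN, mulr1, mul1r).
non_commutative_ring.
Qed.
End Pair.

Lemma hecke_clifford_far (al c1 c2 c3 c4 r1 r3 : E) :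
  (forall x, x * al = al * x) ->
  r1 * c1 = c1 * r1 -> r1 * c2 = c2 * r1 -> r1 * c3 = c3 * r1 -> r1 * c4 = c4 * r1 ->
  r3 * c1 = c1 * r3 -> r3 * c2 = c2 * r3 -> r3 * c3 = c3 * r3 -> r3 * c4 = c4 * r3 ->
  c3 * c1 = - (c1 * c3) -> c3 * c2 = - (c2 * c3) -> c4 * c1 = - (c1 * c4) -> c4 * c2 = - (c2 * c4) ->
  r3 * r1 = - (r1 * r3) ->
  hecke_clifford al c1 c2 r1 * hecke_clifford al c3 c4 r3 =
  hecke_clifford al c3 c4 r3 * hecke_clifford al c1 c2 r1.
Proof.
move=> alC /mulr_rule r11 /mulr_rule r12 /mulr_rule r13 /mulr_rule r14.
move=> /mulr_rule r31 /mulr_rule r32 /mulr_rule r33 /mulr_rule r34.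
move=> /mulr_rule c31 /mulr_rule c32 /mulr_rule c41 /mulr_rule c42 /mulr_rule rr.
have al_r := (mulr_rule (alC c1), mulr_rule (alC c2), mulr_rule (alC c3), mulr_rule (alC c4),
  mulr_rule (alC r1), mulr_rule (alC r3)).
rewrite /hecke_clifford.
rewrite !(mulrDl, mulrDr, mulrBl, mulrBr, mulNr, mulrN, mulr1, mul1r, mulrA).
do !rewrite ?(r11, r12, r13, r14, r31, r32, r33, r34) ?(c31, c32, c41, c42, rr) ?al_r
  !(mulrA, mulNr, mulrN, opprK, mulr1, mul1r).
non_commutative_ring.
Qed.

Section Braid.
Variables (al c1 c2 c3 r1 r2 : E).
Hypothesis alC : forall x, x * al = al * x.
Hypotheses (r11 : r1 * c1 = c1 * r1) (r12 : r1 * c2 = c2 * r1) (r13 : r1 * c3 = c3 * r1).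
Hypotheses (r21 : r2 * c1 = c1 * r2) (r22 : r2 * c2 = c2 * r2) (r23 : r2 * c3 = c3 * r2).
Hypotheses (c11 : c1 * c1 = -1) (c22 : c2 * c2 = -1) (c33 : c3 * c3 = -1).
Hypotheses (c21 : c2 * c1 = - (c1 * c2)) (c31 : c3 * c1 = - (c1 * c3)) (c32 : c3 * c2 = - (c2 * c3)).
Hypothesis rr : r1 * r1 = r2 * r2.
Hypothesis braid : r1 * r2 * r1 = r2 * r1 * r2 + al * al * (r2 - r1).

Let x1 := 1 + c1 * c2.
Let x2 := 1 + c2 * c3.
Let a1 := c1 - c2.
Let a2 := c2 - c3.
Let cc := (mulr_rule c11, mulr_rule c22, mulr_rule c33, mulr_rule c21, mulr_rule c31, mulr_rule c32).

Ltac clifford :=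
  rewrite /x1 /x2 /a1 /a2 !(mulrDl, mulrDr, mulrBl, mulrBr, mulNr, mulrN, mulr1, mul1r, mulrA);
  do ?[rewrite ?cc !(mulrA, mulNr, mulrN, opprK, mulr1, mul1r)]; non_commutative_ring.

(* Both sides of the braid relation are expanded according to the degree in the
   r's.  These identities compare the coefficients; the last two, in degree 1,
   differ by the term a1 * a2 * a1 that the correction in the relation between
   r1 and r2 contributes from degree 3. *)
Let braid_xxx : x1 * x2 * x1 = x2 * x1 * x2. Proof. clifford. Qed.
Let braid_aax : a1 * a2 * x1 = x2 * a1 * a2. Proof. clifford. Qed.
Let braid_xaa : x1 * a2 * a1 = a2 * a1 * x2. Proof. clifford. Qed.
Let braid_axa : a1 * x2 * a1 = a2 * x1 * a2. Proof. clifford. Qed.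
Let braid_aaa : a1 * a2 * a1 = a2 * a1 * a2. Proof. clifford. Qed.
Let braid_xxa : x1 * x2 * a1 + a1 * x2 * x1 = x2 * a1 * x2 + a1 * a2 * a1.
Proof. clifford. Qed.
Let braid_xax : x1 * a2 * x1 = a2 * x1 * x2 + x2 * x1 * a2 - a1 * a2 * a1.
Proof. clifford. Qed.

Lemma hecke_clifford_braid :
  let t1 := hecke_clifford al c1 c2 r1 in let t2 := hecke_clifford al c2 c3 r2 in
  t1 * t2 * t1 = t2 * t1 * t2.
Proof.
have comm1 (x y z : E) : z * x = x * z -> z * y = y * z -> z * (x - y) = (x - y) * z.
  by move=> zx zy; rewrite mulrBr mulrBl zx zy.
have comm2 (x y z : E) : z * x = x * z -> z * y = y * z -> z * (1 + x * y) = (1 + x * y) * z.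
  by move=> zx zy; rewrite mulrDr mulrDl mulr1 mul1r mulrA zx -mulrA zy mulrA.
have ra := (mulr_rule (comm1 _ _ _ r11 r12), mulr_rule (comm1 _ _ _ r12 r13),
  mulr_rule (comm1 _ _ _ r21 r22), mulr_rule (comm1 _ _ _ r22 r23)).
have rx := (mulr_rule (comm2 _ _ _ r11 r12), mulr_rule (comm2 _ _ _ r12 r13),
  mulr_rule (comm2 _ _ _ r21 r22), mulr_rule (comm2 _ _ _ r22 r23)).
rewrite /hecke_clifford -/x1 -/x2 -/a1 -/a2 in ra rx *.
have expand (xa aa ra_ xb ab rb : E) :
    ra_ * xa = xa * ra_ -> ra_ * xb = xb * ra_ -> ra_ * aa = aa * ra_ -> ra_ * ab = ab * ra_ ->
    rb * xa = xa * rb -> rb * aa = aa * rb ->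
  (al * xa + aa * ra_) * (al * xb + ab * rb) * (al * xa + aa * ra_) =
   al * al * al * (xa * xb * xa)
   + al * al * ((xa * xb * aa + aa * xb * xa) * ra_ + xa * ab * xa * rb)
   + al * (xa * ab * aa * (rb * ra_) + aa * xb * aa * (ra_ * ra_) + aa * ab * xa * (ra_ * rb))
   + aa * ab * aa * (ra_ * rb * ra_).
  move=> /mulr_rule e1 /mulr_rule e2 /mulr_rule e3 /mulr_rule e4 /mulr_rule e5 /mulr_rule e6.
  have al_r := (mulr_rule (alC xa), mulr_rule (alC xb), mulr_rule (alC aa), mulr_rule (alC ab),
    mulr_rule (alC ra_), mulr_rule (alC rb)).
  rewrite !(mulrDl, mulrDr, mulrA).
  do ?[rewrite ?al_r ?(e1, e2, e3, e4, e5, e6) !mulrA]; non_commutative_ring.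
clear cc; rewrite !expand; rewrite ?ra ?rx // braid braid_xxx braid_xxa.
rewrite braid_xax rr braid_axa braid_aax braid_xaa braid_aaa.
clear -alC; clearbody x1 x2 a1 a2; have al_r := (mulr_rule (alC a1), mulr_rule (alC a2)).
rewrite !(mulrDl, mulrDr, mulrA).
do ?[rewrite ?al_r !mulrA]; non_commutative_ring.
Qed.
End Braid.
End HeckeClifford.

(** * Reduction of words to products of blocks *)

Local Open Scope nat_scope.

Definition far (i j : nat) := (i.+1 < j) || (j.+1 < i).

Lemma block_word_ge k g : all (leq k) (block_word k g).
Proof.
elim: g k => //= p g IHg k; rewrite all_cat; apply/andP; split.
  by apply/allP => i; rewrite mem_iota => /andP[].
by apply: sub_all (IHg (k + p)) => i; apply: leq_trans; apply: leq_addr.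
Qed.

(** P stands for the words congruent to 0 among the words of one fixed length.
    It is compatible with the braid monoid relations and with rotation, and holds
    as soon as a letter is repeated. *)
Section WordReduction.
Variables (n : nat) (P : seq nat -> Prop).
Notation letters u := (all (fun i => i < n.-1) u).
Hypothesis P_far : forall a b i j, letters (a ++ [:: i, j & b]) -> far i j ->
  P (a ++ [:: j, i & b]) -> P (a ++ [:: i, j & b]).
Hypothesis P_braid : forall a b i, letters (a ++ [:: i, i.+1 & b]) ->
  P (a ++ [:: i, i.+1, i & b]) -> P (a ++ [:: i.+1, i, i.+1 & b]).
Hypothesis P_sq : forall a b i, letters (a ++ i :: b) -> P (a ++ [:: i, i & b]).
Hypothesis P_rot : forall a b, letters (a ++ b) -> P (b ++ a) -> P (a ++ b).
Hypothesis P_block : forall g, all (leq 1) g -> sumn g = n -> P (block_word 0 g).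

(* For goals whose word is made of subwords of the word in H. *)
Ltac solve_letters H :=
  move: H; repeat (progress rewrite ?(all_cat, all_rcons) /=);
  repeat match goal with |- is_true (_ && _) -> _ => case/andP | |- is_true _ -> _ => move=> ? end;
  repeat (apply/andP; split); assumption.

Lemma move_right_past_far i u a b : letters (a ++ i :: u ++ b) -> all (far i) u ->
  P (a ++ u ++ i :: b) -> P (a ++ i :: u ++ b).
Proof.
elim: u a => [|j u IHu] a //= lw /andP[far_ij far_iu] Pu.
apply: P_far => //; rewrite -cat_rcons; apply: IHu => //; rewrite ?cat_rcons //.
solve_letters lw.
Qed.

Lemma move_left_past_far i u a b : letters (a ++ i :: u ++ b) -> all (far i) u ->
  P (a ++ i :: u ++ b) -> P (a ++ u ++ i :: b).
Proof.
elim: u a => [|j u IHu] a //= lw /andP[far_ij far_iu] Pu.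
rewrite -cat_rcons; apply: IHu => //; rewrite ?cat_rcons; first by solve_letters lw.
by apply: P_far; rewrite 1?/far 1?orbC //; solve_letters lw.
Qed.

Lemma split_last_letter (k : nat) (u : seq nat) :
  k \in u -> exists u1 u2, u = u1 ++ k :: u2 /\ k \notin u2.
Proof.
elim: u => //= i u IHu; rewrite inE; case: (boolP (k \in u)) => [ku _|nku].
  by have [u1 [u2 [-> nk]]] := IHu ku; exists (i :: u1), u2.
by rewrite orbF => /eqP <-; exists [::], u.
Qed.

Lemma all_ltnS_notin k u : all (fun i => i < k.+1) u -> k \notin u -> all (fun i => i < k) u.
Proof.
move=> /allP le_uk nku; apply/allP => i iu; rewrite ltn_neqAle -ltnS le_uk // andbT.
by apply: contraNneq nku => <-.
Qed.

Lemma all_far_below k u : all (fun i => i < k) u -> all (far k.+1) u.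
Proof. by apply: sub_all => i lt_ik; rewrite /far ltnS lt_ik orbT. Qed.

(** Between two consecutive occurrences of the top letter k + 1 there is, by
    induction on k, at most one k.  If there is none, the two occurrences can be
    brought together and form a square.  If there is one, they can be brought
    next to it, and the braid relation trades them for a single k + 1. *)
Lemma top_letter_at_most_once k u a b : letters (a ++ u ++ b) -> all (fun i => i < k.+1) u ->
  (forall u', letters (a ++ u' ++ b) -> all (fun i => i < k.+1) u' -> count_mem k u' <= 1 ->
     P (a ++ u' ++ b)) ->
  P (a ++ u ++ b).
Proof.
elim: k u a b => [|k IHk] u a b.
  case: u => [|i [|j u]] /=.
  - by move=> lw _ /(_ [::]); apply.
  - by move=> lw /andP[i0 _] /(_ [:: i]); apply; rewrite //= ?andbT ?addn0 ?leq_b1.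
  move=> lw /and3P[]; rewrite !ltnS !leqn0 => /eqP i0 /eqP j0 _ _.
  rewrite i0 j0 in lw *; apply: P_sq; solve_letters lw.
move: {2}(count_mem k.+1 u) (leqnn (count_mem k.+1 u)) => m.
elim: m u => [|m IHm] u le_um lw lt_u Pu; first by apply: Pu => //; apply: leq_trans le_um _.
have [le_u1|lt1u] := leqP (count_mem k.+1 u) 1; first exact: Pu.
have /split_last_letter[u1 [u3 [def_u nku3]]] : k.+1 \in u.
  by rewrite -has_pred1 has_count ltnW.
have nk3 : count_mem k.+1 u3 = 0 by apply/count_memPn.
have /split_last_letter[u0 [u2 [def_u1 nku2]]] : k.+1 \in u1.
  move: lt1u; rewrite def_u count_cat /= eqxx nk3 addn0 addn1 ltnS.
  by rewrite -has_pred1 has_count.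
have nk2 : count_mem k.+1 u2 = 0 by apply/count_memPn.
move: def_u; rewrite {u1}def_u1 -catA /= => def_u.
rewrite {}def_u in lw lt_u le_um lt1u *.
move: (lt_u); rewrite all_cat /= all_cat /= => /and5P[lt_u0 _ lt_u2 _ lt_u3].
have {lt_u2}lt_u2 := all_ltnS_notin lt_u2 nku2.
have Ecat v : a ++ (u0 ++ k.+1 :: v ++ k.+1 :: u3) ++ b =
    (a ++ u0 ++ [:: k.+1]) ++ v ++ (k.+1 :: u3 ++ b).
  by rewrite -!catA /= -!catA.
rewrite Ecat; apply: IHk => [||v]; rewrite -?Ecat //.
rewrite {}Ecat => lv lt_v; rewrite leq_eqVlt ltnS leqn0 => /orP[/eqP v1|v0]; last first.
  have {}lt_v : all (fun i => i < k) v by apply: all_ltnS_notin => //; apply/count_memPn/eqP.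
  rewrite -!catA catA; apply: (@move_right_past_far _ v); [by solve_letters lv| exact: all_far_below|].
  rewrite catA; apply: P_sq; solve_letters lv.
have /split_last_letter[v0 [v2 [def_v nkv2]]] : k \in v by rewrite -has_pred1 has_count v1.
have nkv0 : k \notin v0.
  apply/count_memPn; move: v1; rewrite def_v count_cat /= eqxx add1n addnS => /eqP.
  by rewrite eqSS addn_eq0 => /andP[/eqP].
rewrite {}def_v in lv lt_v *; move: lt_v; rewrite all_cat /= => /and3P[lt_v0 _ lt_v2].
have {}lt_v0 := all_ltnS_notin lt_v0 nkv0.
have {}lt_v2 := all_ltnS_notin lt_v2 nkv2.
rewrite -!catA catA /=; apply: (@move_right_past_far _ v0); first by solve_letters lv.
  exact: all_far_below.
rewrite /= catA -2!cat_rcons; apply: (@move_left_past_far _ v2); first by solve_letters lv.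
  exact: all_far_below.
rewrite !cat_rcons; apply: P_braid; first by solve_letters lv.
have -> : ((a ++ u0) ++ v0) ++ [:: k, k.+1, k & v2 ++ u3 ++ b] =
  a ++ (u0 ++ v0 ++ [:: k, k.+1, k & v2 ++ u3]) ++ b by rewrite -!catA /= -!catA.
have lt_sub w : all (fun i => i < k) w -> all (fun i => i < k.+2) w.
  by apply: sub_all => i /ltnW; rewrite !ltnS => /leqW.
apply: IHm => //; last 2 first.
- solve_letters lv.
- by rewrite !all_cat /= all_cat lt_u0 lt_u3 !lt_sub //= !ltnS !leqnSn leqnn.
have count0 w : all (fun i => i < k) w -> count_mem k.+1 w = 0.
  move=> /allP lt_wk; apply/count_memPn/negP => /lt_wk.
  by rewrite ltnNge leqnSn.
move: le_um; rewrite !count_cat /= !count_cat /= (count0 v0) // (count0 v2) // nk2 nk3.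
by rewrite eqxx (ltn_eqF (ltnSn k)) /= !addnS ltnS.
Qed.

Lemma swap_far_words u d a b : letters (a ++ u ++ d ++ b) -> allrel far u d ->
  P (a ++ d ++ u ++ b) -> P (a ++ u ++ d ++ b).
Proof.
elim: u a => [|i u IHu] a //= lw; rewrite allrel_consl => /andP[far_id far_ud] Pdu.
rewrite -cat_rcons; apply: IHu => //; first by solve_letters lw.
by rewrite cat_rcons; apply: (@move_right_past_far _ d); first by solve_letters lw.
Qed.

(** The top letter k of u occurs at most once.  If it does not occur, a block of
    size 1 is put in front of the others.  If it does, the letters of u after it
    are far from the blocks, hence can be moved to the end and rotated to the
    front, and k extends the first block to the left.  In both cases the letters
    of u decrease. *)
Lemma word_before_blocks k u g : letters (u ++ block_word k g) ->
  all (fun i => i < k) u -> 0 < size g -> all (leq 1) g -> k + sumn g = n ->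
  P (u ++ block_word k g).
Proof.
elim: k u g => [|k IHk] u g lw lt_u g_nil g_pos def_n.
  by case: u lt_u lw => // _ _; apply: P_block.
rewrite -[u ++ _]/([::] ++ u ++ _); apply: top_letter_at_most_once lt_u _ => // {u lw}/= u lw lt_u.
rewrite leq_eqVlt ltnS leqn0 => /orP[/eqP u1|u0]; last first.
  have {}lt_u : all (fun i => i < k) u by apply: all_ltnS_notin => //; apply/count_memPn/eqP.
  rewrite -[block_word _ _]/(iota k 0 ++ _) -[k.+1]addn1 -/(block_word k (1 :: g)) in lw *.
  by apply: IHk => //=; rewrite addnA addn1.
have /split_last_letter[v0 [v2 [def_u nkv2]]] : k \in u by rewrite -has_pred1 has_count u1.
have nkv0 : k \notin v0.
  apply/count_memPn; move: u1; rewrite def_u count_cat /= eqxx add1n addnS => /eqP.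
  by rewrite eqSS addn_eq0 => /andP[/eqP].
rewrite {}def_u -catA /= in lw lt_u *.
move: lt_u; rewrite all_cat /= => /and3P[lt_v0 _ lt_v2].
have {}lt_v0 := all_ltnS_notin lt_v0 nkv0.
have {}lt_v2 := all_ltnS_notin lt_v2 nkv2.
case: g g_nil g_pos def_n lw => [|[|p] g] //= _ g_pos def_n lw.
(* [p.+1] is the size of the first block, of which [iota k.+1 p] is the word. *)
have def_D : k :: iota k.+1 p ++ block_word (k.+1 + p.+1) g = block_word k (p.+2 :: g).
  by rewrite /= addSnnS.
set D := iota _ _ ++ _ in lw def_D *.
rewrite -cat_rcons -[D]cats0; apply: swap_far_words; first by rewrite cats0; solve_letters lw.
  apply/allrelP => i j /(allP lt_v2) lt_ik; have := block_word_ge k.+1 (p.+1 :: g).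
  by move=> /allP ge_D /ge_D lt_kj; rewrite /far (leq_ltn_trans _ lt_kj).
rewrite cats0 catA; apply: P_rot; first by solve_letters lw.
rewrite cat_rcons def_D catA; apply: IHk => //.
- rewrite -def_D; solve_letters lw.
- by rewrite all_cat lt_v2.
- by rewrite /= -addSnnS.
Qed.

Lemma all_words u : 0 < n -> letters u -> P u.
Proof.
move=> n_gt0 lu; have := @word_before_blocks n.-1 u [:: 1]; rewrite /= cats0.
by apply; rewrite // addn0 addn1 prednK.
Qed.

End WordReduction.

(** * Exchange of blocks by a power of a Coxeter element *)

Local Open Scope ring_scope.

Lemma block_word_cat k g1 g2 :
  block_word k (g1 ++ g2) = block_word k g1 ++ block_word (k + sumn g1) g2.
Proof. by elim: g1 k => [|p g1 IHg] k /=; rewrite ?addn0 // IHg catA addnA. Qed.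

Lemma block_word_shift p k g : block_word (p + k) g = map (addn p) (block_word k g).
Proof. by elim: g k => //= q g IHg k; rewrite map_cat -IHg iotaDl addnA. Qed.

Lemma size_block_word k g : all (leq 1) g -> (size (block_word k g) + size g = sumn g)%N.
Proof.
elim: g k => //= p g IHg k /andP[p_gt0 g_gt0].
by rewrite size_cat size_iota -(IHg (k + p)%N g_gt0); lia.
Qed.

Section BlockSwap.
Variables (E : pzRingType) (t : nat -> E) (n : nat).
Local Notation tword w := (\prod_(i <- w) t i).
Hypothesis t_far : forall i j, (i < n.-1)%N -> (j < n.-1)%N -> far i j -> t i * t j = t j * t i.
Hypothesis t_braid : forall i, (i.+1 < n.-1)%N -> t i * t i.+1 * t i = t i.+1 * t i * t i.+1.

Lemma mul_tword_map x (f g : nat -> nat) (w : seq nat) : {in w, forall i, x * t (f i) = t (g i) * x} ->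
  x * tword (map f w) = tword (map g w) * x.
Proof.
elim: w => [|i w IHw] xw; first by rewrite !big_nil mulr1 mul1r.
rewrite /= !big_cons mulrA xw ?mem_head // -mulrA IHw ?mulrA // => j jw.
by apply: xw; rewrite inE jw orbT.
Qed.

Lemma mul_tword_comm x w : {in w, forall i, x * t i = t i * x} -> x * tword w = tword w * x.
Proof. by move=> xw; rewrite -(map_id w); apply: mul_tword_map. Qed.

Section Coxeter.
Variable m : nat.
Hypothesis le_mn : (m <= n)%N.
Let cox := tword (iota 0 m.-1).

Let lt_n1 i : (i < m.-1)%N -> (i < n.-1)%N.
Proof. by move=> lt_im; apply: leq_trans lt_im _; rewrite -!subn1 leq_sub2r. Qed.

(** Conjugation by the Coxeter element c = t_0 ... t_(m-2) is a rotation of the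
    letters, except that it takes two steps to pass from m - 2 to 0. *)
Lemma coxeter_shift i : (i.+1 < m.-1)%N -> cox * t i = t i.+1 * cox.
Proof.
move=> lt_im; rewrite /cox.
have -> : iota 0 m.-1 = iota 0 i ++ [:: i, i.+1 & iota i.+2 (m.-1 - i.+2)].
  rewrite -{1}(subnKC lt_im) iotaD add0n -[i.+2]addn2 iotaD -catA /=.
  by rewrite add0n.
rewrite big_cat !big_cons /= -!mulrA.
rewrite -(@mul_tword_comm (t i) (iota i.+2 _)); last first.
  move=> j; rewrite mem_iota subnKC // => /andP[lt_ij lt_jm].
  by rewrite t_far ?lt_n1 // ?/far ?lt_ij // (ltn_trans _ lt_im).
have braid x : t i * (t i.+1 * (t i * x)) = t i.+1 * (t i * (t i.+1 * x)).
  by rewrite !mulrA t_braid ?lt_n1.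
rewrite braid [RHS]mulrA (@mul_tword_comm _ (iota 0 i)) -?mulrA // => j.
rewrite mem_iota add0n => /= lt_ji.
have lt_jm : (j < m.-1)%N by apply: ltn_trans lt_im; apply: leqW.
by rewrite t_far ?lt_n1 // /far !ltnS lt_ji orbT.
Qed.

(** If c = Q t_(m-2) = t_0 P, then c Q = P c by the previous lemma, so that
    c c = P c t_(m-2) and t_0 c c = c c t_(m-2). *)
Lemma coxeter_wrap : (1 < m)%N -> cox ^+ 2 * t m.-2 = t 0%N * cox ^+ 2.
Proof.
move=> lt1m; have [k def_m ->] : exists2 k, m.-1 = k.+1 & m.-2 = k.
  by exists m.-2; case: m lt1m => [|[]].
have def_cox : cox = tword (iota 0 k) * t k.
  by rewrite /cox def_m -addn1 iotaD big_cat big_seq1.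
have cox_head : cox * tword (iota 0 k) = tword (iota 1 k) * cox.
  rewrite (iotaDl 1 0) -[X in tword X](map_id (iota 0 k)); apply: mul_tword_map => i.
  by rewrite mem_iota => lt_i; apply: coxeter_shift; rewrite def_m ltnS.
have cox_sq : cox * cox = tword (iota 1 k) * cox * t k.
  by rewrite -cox_head {2}def_cox mulrA.
by rewrite expr2 [in RHS]cox_sq !mulrA; congr (_ * _ * _); rewrite /cox def_m /= big_cons.
Qed.

Lemma coxeter_pow_shift q i : (i + q < m.-1)%N -> cox ^+ q * t i = t (i + q)%N * cox ^+ q.
Proof.
elim: q => [|q IHq] lt_iq; rewrite ?addn0 ?expr0 ?mulr1 ?mul1r //.
rewrite addnS in lt_iq *; rewrite exprS -mulrA IHq; last by apply: ltnW.
by rewrite mulrA coxeter_shift // mulrA.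
Qed.

(** The letter p + i first climbs to m - 2, then wraps to 0, and climbs to i. *)
Lemma coxeter_pow_wrap p q i : (p + q = m)%N -> (i.+1 < q)%N ->
  cox ^+ q * t (p + i)%N = t i * cox ^+ q.
Proof.
move=> def_m lt_iq.
have def_q : q = (i + (2 + (q - i.+2)))%N by rewrite addnA addn2 subnKC.
have def_k : (p + i + (q - i.+2) = m.-2)%N by lia.
have lt_m : (1 < m)%N by lia.
rewrite {1}def_q !exprD -!mulrA coxeter_pow_shift ?def_k; last by lia.
have wrap x : cox * (cox * (t m.-2 * x)) = t 0%N * (cox * (cox * x)).
  by rewrite !mulrA -expr2 coxeter_wrap // expr2 !mulrA.
rewrite wrap mulrA coxeter_pow_shift ?add0n; last by lia.
by rewrite [in RHS]def_q !exprD -!mulrA.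
Qed.

End Coxeter.

(** With q = sumn s2, the q-th power of the Coxeter element of the letters
    below m - 1, m = sumn s1 + q, shifts the blocks of s1 by q and wraps those of
    s2 back to 0, whereas the letters of s3 are far from it. *)
Lemma coxeter_swap_blocks s1 s2 s3 :
    all (leq 1) (s1 ++ s2 ++ s3) -> sumn (s1 ++ s2 ++ s3) = n ->
  let cox := tword (iota 0 (sumn s1 + sumn s2).-1) ^+ sumn s2 in
  cox * tword (block_word 0 (s1 ++ s2 ++ s3)) = tword (block_word 0 (s2 ++ s1 ++ s3)) * cox.
Proof.
rewrite !all_cat !sumn_cat => /and3P[s1_pos s2_pos s3_pos] def_n /=.
set p := sumn s1 in def_n *; set q := sumn s2 in def_n *.
have le_pqn : (p + q <= n)%N by rewrite -def_n addnA leq_addr.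
rewrite !block_word_cat !big_cat /= !add0n -/p -/q (addnC q).
set c := (X in X ^+ q); set cq := c ^+ q.
have -> : tword (block_word p s2) = tword (map (addn p) (block_word 0 s2)).
  by rewrite -block_word_shift addn0.
have shift1 : cq * tword (block_word 0 s1) = tword (block_word q s1) * cq.
  have -> : block_word q s1 = map (addn q) (block_word 0 s1).
    by rewrite -block_word_shift addn0.
  rewrite -{1}[block_word 0 s1]map_id; apply: (@mul_tword_map _ id).
  move=> i /(allP (block_word_lt 0 s1_pos)); rewrite add0n -/p => lt_ip.
  by rewrite [in RHS]addnC; apply: coxeter_pow_shift => //; lia.
have shift2 : cq * tword (map (addn p) (block_word 0 s2)) = tword (block_word 0 s2) * cq.
  rewrite -[in RHS](map_id (block_word 0 s2)); apply: (@mul_tword_map _ (addn p) id).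
  move=> i /(allP (block_word_lt 0 s2_pos)); rewrite add0n -/q => lt_iq.
  by apply: coxeter_pow_wrap => //; lia.
have lt_letter r s i : all (leq 1) s -> i \in block_word r s -> (r <= i < (r + sumn s).-1)%N.
  by move=> s_pos is_; rewrite (allP (block_word_ge r s) _ is_) (allP (block_word_lt r s_pos) _ is_).
have comm3 : cq * tword (block_word (p + q) s3) = tword (block_word (p + q) s3) * cq.
  apply: mul_tword_comm => i /(lt_letter _ _ _ s3_pos) lt_i.
  apply/commr_sym/commrX/commr_sym; rewrite /GRing.comm /c.
  apply/esym/mul_tword_comm => j; rewrite mem_iota => lt_j.
  by apply: t_far; rewrite /far; lia.
rewrite mulrA shift1 -mulrA (mulrA cq) shift2 -mulrA comm3 !mulrA; congr (_ * _ * _).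
apply: mul_tword_comm => i /(lt_letter _ _ _ s2_pos) lt_i.
apply/esym/mul_tword_comm => j /(lt_letter _ _ _ s1_pos) lt_j.
by apply: t_far; rewrite /far; lia.
Qed.
End BlockSwap.

(** * Traces of matrices over an algebra modulo commutators *)

(** H is a ring with a central subring Z, playing the role of A, a subalgebra G,
    playing the role of the integral form, and a Z-submodule S containing the
    commutators of G, playing the role of the elements congruent to 0. *)
Section Cocenter.
Variables (H : pzRingType) (Z G S : H -> Prop).
Hypothesis Z_comm : forall a x, Z a -> a * x = x * a.
Hypothesis Z1 : Z 1.
Hypothesis ZB : forall a b, Z a -> Z b -> Z (a - b).
Hypothesis ZM : forall a b, Z a -> Z b -> Z (a * b).
Hypothesis GZ : forall a, Z a -> G a.
Hypothesis GD : forall x y, G x -> G y -> G (x + y).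
Hypothesis GM : forall x y, G x -> G y -> G (x * y).
Hypothesis SD : forall x y, S x -> S y -> S (x + y).
Hypothesis SZ : forall a x, Z a -> S x -> S (a * x).
Hypothesis S_comm : forall x y, G x -> G y -> S (x * y - y * x).
Variable half : H.
Hypotheses (Z_half : Z half) (half_def : half + half = 1).

Let Z0 : Z 0. Proof. by rewrite -(subrr 1); apply: ZB. Qed.
Let ZN a : Z a -> Z (- a). Proof. by rewrite -sub0r; apply: ZB. Qed.
Let ZD a b : Z a -> Z b -> Z (a + b).
Proof. by move=> Za Zb; rewrite -[b]opprK; apply/ZB/ZN. Qed.

Let S0 : S 0. Proof. by have := S_comm (GZ Z0) (GZ Z0); rewrite subrr. Qed.
Let SN x : S x -> S (- x). Proof. by rewrite -mulN1r; apply/SZ/ZN. Qed.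
Let SB x y : S x -> S y -> S (x - y). Proof. by move=> Sx /SN; apply: SD. Qed.
Let S_trans x y : S (x - y) -> S y -> S x.
Proof. by move=> Sxy /(SD Sxy); rewrite subrK. Qed.
Let S_sum I (r : seq I) (P : pred I) F : (forall i, P i -> S (F i)) -> S (\sum_(i <- r | P i) F i).
Proof. by move=> SF; elim/big_rec: _ => // i x Pi; apply/SD/SF. Qed.
Let S_double x : S (x + x) -> S x.
Proof. by move=> /(SZ Z_half); rewrite mulrDr -mulrDl half_def mul1r. Qed.
Let S_mul2X k x : S (x *+ 2 ^ k) -> S x.
Proof. by elim: k => // k IHk; rewrite expnS mulnC mulrnA mulr2n => /S_double. Qed.

Section Matrices.
Variable N : nat.
Implicit Types A B C : 'M[H]_N.
Definition entries (P : H -> Prop) A := forall i j, P (A i j).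

Let GMsum I (r : seq I) (P : pred I) F : (forall i, P i -> G (F i)) -> G (\sum_(i <- r | P i) F i).
Proof. by move=> GF; elim/big_rec: _ => [|i x Pi]; [apply: GZ | apply/GD/GF]. Qed.

Lemma entriesM A B : entries G A -> entries G B -> entries G (A * B).
Proof. by move=> GA GB i j; rewrite mxE; apply: GMsum => k _; apply: GM. Qed.
Lemma entriesZ_G A : entries Z A -> entries G A.
Proof. by move=> ZA i j; apply/GZ. Qed.
Lemma entriesD A B : entries G A -> entries G B -> entries G (A + B).
Proof. by move=> GA GB i j; rewrite mxE; apply: GD. Qed.
Lemma entriesZM A B : entries Z A -> entries Z B -> entries Z (A * B).
Proof.
move=> GA GB i j; rewrite mxE; elim/big_rec: _ => // k x _; apply: ZD.
exact: ZM.
Qed.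
Lemma entriesZB A B : entries Z A -> entries Z B -> entries Z (A - B).
Proof. by move=> GA GB i j; rewrite !mxE; apply: ZB. Qed.
Lemma entries_scalar (P : H -> Prop) a : P 0 -> P a -> entries P (a%:M).
Proof. by move=> P0 Pa i j; rewrite mxE; case: eqP. Qed.
Lemma entriesZ1 : entries Z 1. Proof. exact: entries_scalar. Qed.
Lemma entriesN A : entries G A -> entries G (- A).
Proof. by move=> GA i j; rewrite mxE -mulN1r; apply: GM => //; apply/GZ/ZN. Qed.
Lemma entriesB A B : entries G A -> entries G B -> entries G (A - B).
Proof. by move=> GA GB; apply/entriesD/entriesN. Qed.

Lemma S_trace_comm A B : entries G A -> entries G B -> S (\tr (A * B) - \tr (B * A)).
Proof.
move=> GA GB; rewrite /mxtrace.
rewrite (eq_bigr (fun i => \sum_j A i j * B j i)) => [|i _]; last by rewrite mxE.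
rewrite [X in _ - X](eq_bigr (fun i => \sum_j B i j * A j i)) => [|i _]; last by rewrite mxE.
rewrite [X in _ - X]exchange_big -sumrB; apply: S_sum => i _.
by rewrite -sumrB; apply: S_sum => j _; apply: S_comm.
Qed.

(** Conjugation by c changes the sign of A but not, modulo S, that of its trace;
    and 2 is invertible. *)
Lemma S_trace_anti c A : entries G c -> entries G A -> c * c = -1 ->
  c * A = - (A * c) -> S (\tr A).
Proof.
move=> Gc GA cc anti; apply: S_double.
have := S_trace_comm Gc (entriesM Gc GA); rewrite mulrA cc mulN1r anti mulNr -mulrA cc mulrN1 opprK.
by rewrite raddfN /= => /SN; rewrite opprB opprK.
Qed.

Lemma scalar_comm c h : entries Z c -> h%:M * c = c * h%:M.
Proof.
move=> Zc; apply/matrixP => i j; rewrite -[_ * c]/(_ *m c) mul_scalar_mx !mxE.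
rewrite (bigD1 j) //= big1 => [|k nk]; first by rewrite addr0 mxE eqxx mulr1n (Z_comm _ (Zc i j)).
by rewrite mxE (negbTE nk) mulr0n mulr0.
Qed.

Lemma trace_mul_scalar c h : entries Z c -> \tr (c * h%:M) = \tr c * h.
Proof.
move=> Zc; rewrite -scalar_comm // -[_ * _]/(_ *m _) mul_scalar_mx /mxtrace mulr_suml.
by apply: eq_bigr => i _; rewrite mxE (Z_comm _ (Zc i i)).
Qed.

Lemma trace_Z c : entries Z c -> Z (\tr c).
Proof. by move=> Zc; rewrite /mxtrace; elim/big_rec: _ => // k x _; apply: ZD. Qed.

End Matrices.

(** Clifford matrices double in size with each new generator: c becomes
    diag(c, -c), and the new one is [[0, 1], [-1, 0]]. *)
Lemma clifford_matrices m : exists k (c : nat -> 'M[H]_(2 ^ k)),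
  [/\ forall i, entries Z (c i), forall i, (i < m)%N -> c i * c i = -1 &
      forall i j, (i < m)%N -> (j < m)%N -> i != j -> c i * c j = - (c j * c i)].
Proof.
suff [N [[k ->] Ck]] : exists N, (exists k, N = 2 ^ k)%N /\ exists c : nat -> 'M[H]_N,
  [/\ forall i, entries Z (c i), forall i, (i < m)%N -> c i * c i = -1 &
      forall i j, (i < m)%N -> (j < m)%N -> i != j -> c i * c j = - (c j * c i)].
  by exists k.
elim: m => [|m [N [[k def_N] [c [Zc csq canti]]]]].
  by exists 1%N; split; [exists 0%N | exists (fun=> 0); split=> // i k l; rewrite mxE].
exists (N + N)%N; split; first by exists k.+1; rewrite def_N expnS mul2n addnn.
pose d i := if (i < m)%N then block_mx (c i) 0 0 (- c i) else block_mx 0 1%:M (- 1%:M) 0.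
have Zblock (a b e f : 'M[H]_N) : entries Z a -> entries Z b -> entries Z e -> entries Z f ->
    entries Z (block_mx a b e f).
  by move=> Za Zb Ze Zf i j; rewrite !mxE; case: split => ?; rewrite mxE; case: split => ?.
have Zn (a : 'M[H]_N) : entries Z a -> entries Z (- a) by move=> Za i j; rewrite mxE; apply: ZN.
have Z00 : entries Z (0 : 'M[H]_N) by move=> i j; rewrite mxE.
have dM : forall a b e f a' b' e' f' : 'M[H]_N,
   (block_mx a b e f : 'M[H]_(N + N)) * block_mx a' b' e' f' =
   block_mx (a * a' + b * e') (a * b' + b * f') (e * a' + f * e') (e * b' + f * f').
  by move=> *; apply: mulmx_block.
have d1 : (-1 : 'M[H]_(N + N)) = block_mx (-1) 0 0 (-1).
  by rewrite -[1]/(1%:M) scalar_mx_block opp_block_mx !oppr0.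
exists d; split=> [i|i lt_im|i j lt_im lt_jm neq_ij].
- by rewrite /d; case: ifP => _; apply: Zblock => //; try apply: Zn => //; apply: entriesZ1.
- rewrite /d; case: ifP => lt_i; rewrite dM d1.
    by rewrite !(mul0r, mulr0, addr0, add0r) mulNr mulrN opprK csq.
  by rewrite !(mul0r, mulr0, addr0, add0r) mul1r mulr1.
rewrite /d; case: ifP => lt_i; case: ifP => lt_j; rewrite !dM opp_block_mx.
- by rewrite !(mul0r, mulr0, addr0, add0r) !mulNr !mulrN !opprK !oppr0 canti // opprK.
- by rewrite !(mul0r, mulr0, addr0, add0r) !mulr1 !mulrN !mulr1 ?mul1r !oppr0 !opprK ?mulNr ?mul1r ?opprK.
- by rewrite !(mul0r, mulr0, addr0, add0r) !mulr1 !mulrN !mulr1 ?mul1r !oppr0 !opprK ?mulNr ?mul1r ?opprK.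
by exfalso; lia.
Qed.

(** * The spin relations and words of a given length *)

Variables (n : nat) (X : nat -> H) (v vinv : H).
Hypotheses (Z_v : Z v) (Z_vinv : Z vinv) (mul_v_inv : v * vinv = 1).
Hypothesis G_X : forall i, G (X i).
Hypothesis X_sq : forall i, (i < n.-1)%N -> X i * X i = - (v * v + 1).
Hypothesis X_far : forall i j, (i < n.-1)%N -> (j < n.-1)%N -> far i j -> X i * X j = - (X j * X i).
Hypothesis X_braid : forall i, (i.+1 < n.-1)%N ->
  X i * X i.+1 * X i - X i.+1 * X i * X i.+1 = (v - 1) * (v - 1) * (X i.+1 - X i).
Local Notation xword w := (\prod_(i <- w) X i).
Local Notation letters u := (all (fun i => i < n.-1)%N u).

Let G_xword w : G (xword w).
Proof. by elim/big_rec: _ => [|i x _]; [apply: GZ | apply: GM]. Qed.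

(** One step of the strong induction: words of even length below L are in S. *)
Section Level.
Variable L : nat.
Hypothesis L_even : ~~ odd L.
Hypothesis S_lower : forall w, letters w -> ~~ odd (size w) -> (size w < L)%N -> S (xword w).

Section HeckeCliffordAlgebra.
Variables (k : nat) (c : nat -> 'M[H]_(2 ^ k)).
Hypothesis Zc : forall i, entries Z (c i).
Hypothesis c_sq : forall i, (i < n.+1)%N -> c i * c i = -1.
Hypothesis c_anti : forall i j, (i < n.+1)%N -> (j < n.+1)%N -> i != j -> c i * c j = - (c j * c i).

Local Notation E := 'M[H]_(2 ^ k).
Local Notation al := ((v - 1)%:M : E).
Definition spin_mx w : E := (xword w)%:M.
(** The generators c_0, ..., c_(n-1) occur here; c_n is kept apart, as a grading
    operator. *)
Definition hecke_gen i : E := hecke_clifford al (c i) (c i.+1) (X i)%:M.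
Local Notation tword w := (\prod_(i <- w) hecke_gen i).
Definition edge_prod w : E := \prod_(i <- w) (c i - c i.+1).

Let scalarM a b : ((a * b)%:M : E) = a%:M * b%:M. Proof. exact: scalar_mxM. Qed.
Let G_scalar a : G a -> entries G (a%:M : E).
Proof. by move=> Ga; apply: entries_scalar => //; apply: GZ. Qed.
Let Z_al : entries Z al. Proof. by apply: entries_scalar => //; apply: ZB. Qed.
Let Z_scalar_comm z (x : E) : Z z -> x * z%:M = z%:M * x.
Proof.
move=> Zz; rewrite -[RHS]/(_ *m _) mul_scalar_mx; apply/matrixP => i j; rewrite !mxE.
rewrite (bigD1 j) //= big1 => [|l nl]; first by rewrite addr0 mxE eqxx mulr1n -(Z_comm _ Zz).
by rewrite mxE (negbTE nl) mulr0n mulr0.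
Qed.
Let al_comm (x : E) : x * al = al * x.
Proof. by apply: Z_scalar_comm; apply: ZB. Qed.
Let ltn_letter i : (i < n.-1)%N -> [/\ i < n.+1, i.+1 < n.+1 & i.+1 < n]%N.
Proof. by move=> lt_i; split; lia. Qed.

Lemma entries_hecke_gen i : entries G (hecke_gen i).
Proof.
apply: entriesD; apply: entriesM; last exact: G_scalar.
- exact: entriesZ_G.
- by apply/entriesD/entriesM; apply: entriesZ_G => //; apply: entriesZ1.
by apply: entriesB; apply: entriesZ_G.
Qed.

Let hecke_gen_far i j : (i < n.-1)%N -> (j < n.-1)%N -> far i j ->
  hecke_gen i * hecke_gen j = hecke_gen j * hecke_gen i.
Proof.
move=> lt_i lt_j far_ij; have [lt_i1 lt_i2 _] := ltn_letter lt_i.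
have [lt_j1 lt_j2 _] := ltn_letter lt_j.
rewrite /far in far_ij.
apply: hecke_clifford_far => //; try (by apply: scalar_comm); try (by apply: c_anti => //; lia).
by rewrite -!scalarM X_far // 1?/far 1?orbC // raddfN.
Qed.

Let hecke_gen_braid i : (i.+1 < n.-1)%N ->
  hecke_gen i * hecke_gen i.+1 * hecke_gen i = hecke_gen i.+1 * hecke_gen i * hecke_gen i.+1.
Proof.
move=> lt_i; apply: hecke_clifford_braid => //; try (by apply: scalar_comm); try (by apply: c_sq; lia);
  try (by apply: c_anti => //; lia).
- by rewrite -!scalarM !X_sq //; lia.
by rewrite -!scalarM -raddfB -scalarM -raddfD /= -X_braid // addrC subrK.
Qed.

Definition invertible (U : E) := entries G U /\ exists V, [/\ entries G V, U * V = 1 & V * U = 1].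

Lemma invertibleM U V : invertible U -> invertible V -> invertible (U * V).
Proof.
move=> [GU [U' [GU' UU' U'U]]] [GV [V' [GV' VV' V'V]]]; split; first exact: entriesM.
exists (V' * U'); split; first exact: entriesM.
  by rewrite -mulrA (mulrA V) VV' mul1r.
by rewrite -mulrA (mulrA U') U'U mul1r.
Qed.

Lemma invertible1 : invertible 1.
Proof. by split; [|exists 1; rewrite mulr1; split=> //]; apply/entriesZ_G/entriesZ1. Qed.

(** T (T - 2 (v - 1)) = 4 v, and 4 v is a unit. *)
Lemma invertible_hecke_gen i : (i < n.-1)%N -> invertible (hecke_gen i).
Proof.
move=> lt_i; have [lt_i1 lt_i2 _] := ltn_letter lt_i; split; first exact: entries_hecke_gen.
pose u : H := vinv * half * half.
have Zu : Z u by do 2?apply: ZM.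
have quad : hecke_gen i * (hecke_gen i - (al + al)) = ((v * v + 1)%:M + (v * v + 1)%:M) - (al * al + al * al).
  apply: hecke_clifford_quadratic => //; try (by apply: scalar_comm); try (by apply: c_sq).
    by apply: c_anti => //; lia.
  by rewrite -scalarM X_sq // raddfN.
have four_v : v * v + 1 + (v * v + 1) - ((v - 1) * (v - 1) + (v - 1) * (v - 1)) = v * (1 + 1 + (1 + 1)).
  non_commutative_ring.
have uv : v * (1 + 1 + (1 + 1)) * u = 1.
  have four_half : (1 + 1 + (1 + 1)) * (half * half) = 1.
    by rewrite !mulrDl !mul1r -!mulrDl half_def mulrDl mul1r half_def.
  have Z4 : Z (1 + 1 + (1 + 1)) by do 2?apply: ZD.
  by rewrite /u -mulrA -(mulrA vinv) (mulrA (_ + _)) (Z_comm _ Z4) -mulrA four_half mulr1.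
have uM (x : E) : x * u%:M = u%:M * x by apply: Z_scalar_comm.
exists (u%:M * (hecke_gen i - (al + al))).
have comm_t : hecke_gen i * (hecke_gen i - (al + al)) = (hecke_gen i - (al + al)) * hecke_gen i.
  by apply: commrB => //; apply: commrD; apply: al_comm.
have inv : hecke_gen i * (u%:M * (hecke_gen i - (al + al))) = 1.
  rewrite -uM mulrA quad -!scalarM -!raddfD -raddfB /= -scalarM.
  by rewrite four_v uv.
split=> //; last by rewrite -mulrA -comm_t -uM -mulrA uM.
apply: entriesM; first exact/G_scalar/GZ.
by apply/entriesB/entriesD; first exact: entries_hecke_gen; apply: entriesZ_G.
Qed.

Lemma invertibleX U m : invertible U -> invertible (U ^+ m).
Proof. by move=> inv_U; elim: m => [|m]; [apply: invertible1 | rewrite exprS; apply: invertibleM]. Qed.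

Lemma invertible_tword w : letters w -> invertible (tword w).
Proof.
move=> /allP lw; rewrite big_seq; elim/big_rec: _ => [|i x /lw lt_i inv_x]; first exact: invertible1.
by apply: invertibleM => //; apply: invertible_hecke_gen.
Qed.

(** Parity in the Clifford generators c_0, ..., c_(n-1), read off from c_n, which
    anticommutes with each of them. *)
Definition parity (b : bool) (x : E) := c n * x = if b then - (x * c n) else x * c n.

Lemma parityM b1 b2 x y : parity b1 x -> parity b2 y -> parity (b1 (+) b2) (x * y).
Proof.
rewrite /parity => px py; rewrite mulrA px; case: b1 {px} => /=;
  rewrite ?mulNr -[x * c n * y]mulrA py; case: b2 {py} => /=; by rewrite ?mulrN ?opprK !mulrA.
Qed.

Lemma parity_c i : (i < n)%N -> parity true (c i).
Proof. by move=> lt_in; apply: c_anti; lia. Qed.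

Lemma parityB b x y : parity b x -> parity b y -> parity b (x - y).
Proof.
by rewrite /parity => px py; rewrite mulrBr mulrBl px py; case: b {px py}; rewrite ?opprB ?opprK // addrC.
Qed.

(** The matrices of filtration degree less than m in the X_i.  The Clifford
    coefficient has the same parity as the word, as in the expansion of a product
    of Hecke generators. *)
Inductive lower (m : nat) : E -> Prop :=
| lower0 : lower m 0
| lowerD x y : lower m x -> lower m y -> lower m (x + y)
| lower_gen d w : entries Z d -> letters w -> (size w < m)%N -> parity (odd (size w)) d ->
    lower m (d * spin_mx w).

(** A term with an odd word has a coefficient that anticommutes with c_n, hence
    its trace is in S whatever the word is.  The other words are shorter even
    words. *)
Lemma S_trace_lower x : lower L x -> S (\tr x).
Proof.
elim=> [|{}x y _ Sx _ Sy|d w Zd lw lt_w par].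
- by rewrite raddf0.
- by rewrite raddfD; apply: SD.
case: (boolP (odd (size w))) => [odd_w|ev_w]; last first.
  by rewrite trace_mul_scalar //; apply/SZ/S_lower => //; apply: trace_Z.
apply: (@S_trace_anti _ (c n)) => //; first exact: entriesZ_G.
- by apply: entriesM; [apply: entriesZ_G | apply: G_scalar].
- exact: c_sq.
by rewrite mulrA par odd_w mulNr -!mulrA scalar_comm.
Qed.

Lemma entries_const i : entries Z (al * (1 + c i * c i.+1)).
Proof.
apply: entriesZM => //; rewrite -[_ * _]opprK; apply: entriesZB; first exact: entriesZ1.
by rewrite -sub0r; apply: entriesZB => [i' j'|]; [rewrite mxE | apply: entriesZM].
Qed.

Lemma parity_const i : (i.+1 < n)%N -> parity false (al * (1 + c i * c i.+1)).
Proof.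
move=> lt_i; apply: commrM; first exact: al_comm.
apply: commrD; first exact: commr1.
by rewrite /GRing.comm (@parityM true true) //; apply: parity_c; lia.
Qed.

Lemma lower_hecke_genM i x m : (i < n.-1)%N -> lower m x -> lower m.+1 (hecke_gen i * x).
Proof.
move=> lt_i; have [lt_i1 lt_i2 lt_i3] := ltn_letter lt_i.
elim=> [|{}x y _ Sx _ Sy|d w Zd lw lt_w par].
- by rewrite mulr0; apply: lower0.
- by rewrite mulrDr; apply: lowerD.
rewrite /hecke_gen /hecke_clifford mulrDl; apply: lowerD.
  rewrite mulrA; apply: lower_gen => //; first by apply/entriesZM/Zd/entries_const.
    exact: leqW.
  by rewrite -[odd _]addFb; apply: parityM => //; apply: parity_const; lia.
have -> : (c i - c i.+1) * (X i)%:M * (d * spin_mx w) = (c i - c i.+1) * d * spin_mx (i :: w).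
  by rewrite /spin_mx big_cons scalarM -!mulrA; congr (_ * _); rewrite !mulrA scalar_comm.
apply: lower_gen => //=; first by apply/entriesZM/Zd/entriesZB.
- by rewrite lt_i.
rewrite -addTb; apply: parityM => //; apply: parityB; apply: parity_c; lia.
Qed.

Lemma parity_edge_prod w : letters w -> parity (odd (size w)) (edge_prod w).
Proof.
elim: w => [|i w IHw] /=; first by rewrite /edge_prod big_nil /parity mulr1 mul1r.
move=> /andP[lt_i lw]; rewrite /edge_prod big_cons -addTb; apply: parityM; last exact: IHw.
by apply: parityB; apply: parity_c; lia.
Qed.

Lemma entries_edge_prod w : entries Z (edge_prod w).
Proof.
by rewrite /edge_prod; elim/big_rec: _ => [|i x _ Zx]; [apply: entriesZ1 | apply/entriesZM/Zx/entriesZB].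
Qed.

(** Each factor of the product is (c_i - c_(i+1)) X_i up to a term without X_i. *)
Lemma tword_leading w : letters w -> lower (size w) (tword w - edge_prod w * spin_mx w).
Proof.
elim: w => [|i w IHw] /= => [_|/andP[lt_i lw]].
  by rewrite /edge_prod /spin_mx !big_nil mul1r subrr; apply: lower0.
have [lt_i1 lt_i2 lt_i3] := ltn_letter lt_i.
have -> : tword (i :: w) - edge_prod (i :: w) * spin_mx (i :: w) =
   hecke_gen i * (tword w - edge_prod w * spin_mx w) + (al * (1 + c i * c i.+1) * edge_prod w) * spin_mx w.
  rewrite /edge_prod /spin_mx !big_cons scalarM -/(spin_mx w) -/(edge_prod w) /hecke_gen /hecke_clifford.
  have comm_x : (X i)%:M * edge_prod w = edge_prod w * (X i)%:M by apply/scalar_comm/entries_edge_prod.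
  exact: mul_leading_term.
apply: lowerD; first exact/lower_hecke_genM/IHw.
apply: lower_gen => //; first by apply/entriesZM/entries_edge_prod/entries_const.
by rewrite -[odd _]addFb; apply: parityM; [apply: parity_const | apply: parity_edge_prod].
Qed.

(** The blocks of odd size p consist of (p - 1) / 2 pairs of consecutive letters. *)
Inductive paired : seq nat -> Prop :=
| paired_nil : paired [::]
| paired_cons i w : all (leq i.+2) w -> paired w -> paired [:: i, i.+1 & w].

Lemma paired_block k0 g : all odd g -> paired (block_word k0 g).
Proof.
elim: g k0 => [|p g IHg] k0 /=; first by move=> _; apply: paired_nil.
move=> /andP[odd_p odd_g]; have := IHg (k0 + p)%N odd_g; have := block_word_ge (k0 + p)%N g.
move: (block_word _ g) => w {IHg odd_g}.
have [r def_p] : exists r, p = r.*2.+1 by exists p./2; rewrite -[LHS]odd_double_half odd_p.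
rewrite {p odd_p}def_p; elim: r k0 => [|r IHr] k0 ge_w pw //=.
apply: paired_cons; last by apply: IHr => //; apply: sub_all ge_w => l; lia.
rewrite all_cat; apply/andP; split; first by apply/allP => i; rewrite mem_iota => /andP[].
by apply: sub_all ge_w => i; apply: leq_trans; rewrite doubleS !addnS !ltnS -addnS leq_addr.
Qed.

Lemma paired_size w : paired w -> ~~ odd (size w).
Proof. by elim=> //= i w' _ _; rewrite negbK. Qed.

Lemma clifford_edge_prod j w : letters w -> (j < n)%N -> all (leq j.+1) w ->
  c j * edge_prod w = if odd (size w) then - (edge_prod w * c j) else edge_prod w * c j.
Proof.
move=> lw lt_j; elim: w lw => [|i w IHw] /=; first by rewrite /edge_prod big_nil mulr1 mul1r.
move=> /andP[lt_i lw] /andP[lt_ji ge_w]; rewrite /edge_prod big_cons -/(edge_prod w).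
have anti : c j * (c i - c i.+1) = - ((c i - c i.+1) * c j).
  by rewrite mulrBr mulrBl !(c_anti (i := j)) ?opprB ?opprK 1?addrC //; lia.
rewrite mulrA anti mulNr -[_ * c j * _]mulrA IHw //.
by case: (odd _); rewrite /= ?mulrN ?opprK !mulrA.
Qed.

Lemma S_trace_pair a b (y : E) : entries Z a -> entries Z b -> entries G y ->
  a * a = -1 -> a * b = - (b * a) -> a * y = y * a -> S (\tr (a * b * y)).
Proof.
move=> Za Zb Gy aa ab ay; apply: (@S_trace_anti _ a) => //; first exact: entriesZ_G.
  by apply: entriesM => //; apply: entriesM; apply: entriesZ_G.
have aba : a * b * a = b by rewrite ab mulNr -mulrA aa mulrN1 opprK.
by rewrite -[_ * y * a]mulrA -ay [in RHS]mulrA aba !mulrA aa mulN1r mulNr.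
Qed.

(** The Clifford factor of the leading term behaves as 1 under the trace.  The
    first pair
    of letters contributes
      (c_i - c_(i+1)) (c_(i+1) - c_(i+2))
        = 1 + c_i c_(i+1) - c_i c_(i+2) + c_(i+1) c_(i+2),
    and each of the last three products anticommutes with c_i or c_(i+1), which
    commutes with the remaining pairs. *)
Lemma trace_edge_prod w y : paired w -> letters w -> entries G y ->
   (forall i, (i < n)%N -> c i * y = y * c i) -> S (\tr (edge_prod w * y) - \tr y).
Proof.
move=> pw lw Gy cy; elim: pw lw => [|i w' ge_w pw IHw] /=.
  by rewrite /edge_prod big_nil mul1r subrr.
move=> /and3P[lt_i lt_i1 lw]; apply: S_trans (IHw lw); rewrite opprB addrA subrK.
pose Y := edge_prod w' * y.
have GY : entries G Y by apply: entriesM => //; apply/entriesZ_G/entries_edge_prod.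
have cY j : (j <= i.+1)%N -> c j * Y = Y * c j.
  move=> le_j; rewrite /Y mulrA clifford_edge_prod //; last 1 first.
  - by apply: sub_all ge_w => l; apply: leq_ltn_trans.
  - by rewrite (negbTE (paired_size pw)) -!mulrA cy //; lia.
  lia.
have -> : edge_prod [:: i, i.+1 & w'] * y = c i * c i.+1 * Y - c i * c i.+2 * Y + c i.+1 * c i.+2 * Y + Y.
  by rewrite /edge_prod !big_cons -/(edge_prod w') -!mulrA -/Y mul_edge_pair ?mulrA //; apply: c_sq; lia.
rewrite -/Y -raddfB addrK !raddfD raddfN /=; apply: SD; first apply: SB.
- by apply: S_trace_pair => //; [apply: c_sq; lia | apply: c_anti; lia | apply: cY].
- by apply: S_trace_pair => //; [apply: c_sq; lia | apply: c_anti; lia | apply: cY].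
by apply: S_trace_pair => //; [apply: c_sq; lia | apply: c_anti; lia | apply: cY].
Qed.

(** For odd blocks, the trace of the product of Hecke generators recovers the
    spin word, up to shorter words and the invertible factor 2 ^ k. *)
Lemma S_block_trace g : all odd g -> sumn g = n -> size (block_word 0 g) = L ->
  S (\tr (tword (block_word 0 g)) - xword (block_word 0 g) *+ 2 ^ k).
Proof.
move=> odd_g sum_g size_g; set w := block_word 0 g.
have g_pos : all (leq 1) g by apply: sub_all odd_g => -[].
have lw : letters w by have := block_word_lt 0 g_pos; rewrite add0n sum_g.
have /S_trace_lower : lower L (tword w - edge_prod w * spin_mx w) by rewrite -size_g; apply: tword_leading.
rewrite raddfB /= => Sw.
have := @trace_edge_prod w (spin_mx w) (paired_block 0 odd_g) lw (G_scalar (G_xword w)).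
move=> /(_ _)/(SD Sw); rewrite addrA subrK {2}/spin_mx mxtrace_scalar; apply.
by move=> i _; apply/esym/scalar_comm.
Qed.

(** The two products of Hecke generators are conjugate, so have congruent traces. *)
Lemma S_block_swap s1 s2 s3 (g := s1 ++ s2 ++ s3) (g' := s2 ++ s1 ++ s3) :
  all odd g -> sumn g = n -> size (block_word 0 g) = L -> size (block_word 0 g') = L ->
  S (xword (block_word 0 g)) -> S (xword (block_word 0 g')).
Proof.
move=> odd_g sum_g size_g size_g' Sg.
have perm_g : perm_eq g g' by rewrite /g /g' perm_catCA.
have odd_g' : all odd g' by rewrite -(perm_all _ perm_g).
have sum_g' : sumn g' = n by rewrite -(perm_sumn perm_g).
have g_pos : all (leq 1) g by apply: sub_all odd_g => -[].
have tg := S_block_trace odd_g sum_g size_g.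
have tg' := S_block_trace odd_g' sum_g' size_g'.
set m := (sumn s1 + sumn s2)%N; set U : E := tword (iota 0 m.-1) ^+ sumn s2.
have [GU [V [GV UV VU]]] : invertible U.
  apply/invertibleX/invertible_tword/allP => i; rewrite mem_iota.
  by move: sum_g; rewrite /g !sumn_cat -/m; lia.
have swap : U * tword (block_word 0 g) = tword (block_word 0 g') * U.
  exact: (coxeter_swap_blocks hecke_gen_far hecke_gen_braid).
have Gt : entries G (tword (block_word 0 g)).
  by elim/big_rec: _ => [|i x _ Gx]; [apply/entriesZ_G/entriesZ1 | apply/entriesM/Gx/entries_hecke_gen].
have tr_eq : S (\tr (tword (block_word 0 g')) - \tr (tword (block_word 0 g))).
  have := S_trace_comm (entriesM GU Gt) GV.
  by rewrite {1}swap -mulrA UV mulr1 mulrA VU mul1r.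
apply: (@S_mul2X k); set x := _ *+ _.
have SMn y m' : S y -> S (y *+ m').
  by move=> Sy; elim: m' => [|m' IHm]; rewrite ?mulr0n ?mulrS //; apply: SD.
have /(S_trans tr_eq) := S_trans tg (SMn _ _ Sg).
by move: tg'; rewrite -/x => /SN; rewrite opprB; apply: S_trans.
Qed.
End HeckeCliffordAlgebra.

Hypothesis S_sorted : forall g, all odd g -> sumn g = n -> sorted geq g -> S (xword (block_word 0 g)).

Lemma S_odd_composition g : all odd g -> sumn g = n -> size (block_word 0 g) = L ->
  S (xword (block_word 0 g)).
Proof.
move=> odd_g sum_g size_g.
have [k [c [Zc c_sq c_anti]]] := clifford_matrices n.+1.
have pos_g s : all odd s -> all (leq 1) s by apply: sub_all => -[].
pose P s := [/\ all odd s, sumn s = n & size (block_word 0 s) = L] -> S (xword (block_word 0 s)).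
suff: P g by apply.
have perm_sort : perm_eq (sort geq g) g by rewrite perm_sort.
apply: (@catCA_perm_ind _ P) perm_sort _ => [s1 s2 s3 IH|].
  move=> [odd_s sum_s size_s].
  have perm_s : perm_eq (s2 ++ s1 ++ s3) (s1 ++ s2 ++ s3) by rewrite perm_catCA.
  have odd_s' : all odd (s1 ++ s2 ++ s3) by rewrite -(perm_all _ perm_s).
  have sum_s' : sumn (s1 ++ s2 ++ s3) = n by rewrite -(perm_sumn perm_s).
  have size_s' : size (block_word 0 (s1 ++ s2 ++ s3)) = L.
    apply: (@addIn (size (s1 ++ s2 ++ s3))); rewrite size_block_word ?pos_g // sum_s' -sum_s.
    by rewrite -(size_block_word 0) ?pos_g // size_s (perm_size perm_s).
  by apply: (S_block_swap Zc c_sq c_anti) => //; apply: IH.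
move=> [odd_s sum_s _]; apply: S_sorted => //; apply: sort_sorted.
by move=> i j; rewrite /= leq_total.
Qed.

Lemma xword_far u w : letters u -> letters w -> allrel far u w ->
  xword u * xword w = if odd (size u) && odd (size w) then - (xword w * xword u) else xword w * xword u.
Proof.
elim: u w => [|i u IHu] w; first by rewrite big_nil mul1r mulr1.
move=> /= /andP[lt_i lu] lw; rewrite allrel_consl => /andP[far_iw far_uw].
have far1 : X i * xword w = if odd (size w) then - (xword w * X i) else xword w * X i.
  elim: w lw far_iw {far_uw} => [|j w IHw] /=; first by rewrite big_nil mul1r mulr1.
  move=> /andP[lt_j lw] /andP[far_ij far_iw]; rewrite big_cons mulrA X_far // mulNr -mulrA IHw //.
  by case: (odd _); rewrite /= ?mulrN ?opprK !mulrA.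
rewrite big_cons -mulrA IHu //; case: (odd (size u)) => /=; case: (odd (size w)) far1 => /= far1;
  by rewrite ?mulrN mulrA far1 ?mulNr ?opprK mulrA.
Qed.

(** The block b of an even part has odd length, as has the rest d ++ a of the
    word, so the two anticommute, whereas they commute modulo commutators. *)
Lemma S_even_part g : all (leq 1) g -> ~~ all odd g -> sumn g = n -> size (block_word 0 g) = L ->
  S (xword (block_word 0 g)).
Proof.
move=> g_pos not_odd sum_g size_g.
have [p pg even_p] : exists2 p, p \in g & ~~ odd p by apply/allPn.
have [g1 [g2 def_g]] : exists g1 g2, g = g1 ++ p :: g2.
  by case/splitPr: pg => g1 g2; exists g1, g2.
rewrite {}def_g in g_pos not_odd sum_g size_g *.
move: (g_pos); rewrite all_cat /= => /and3P[g1_pos p_pos g2_pos].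
move: sum_g size_g; rewrite sumn_cat /= block_word_cat add0n !size_cat /= => sum_g size_g.
set a := block_word 0 g1 in size_g *; set q := sumn g1 in size_g sum_g *.
rewrite size_iota in size_g.
set b := iota q p.-1; set d := block_word (q + p) g2 in size_g *.
have lt_a i : i \in a -> (i < q.-1)%N by move=> /(allP (block_word_lt 0 g1_pos)); rewrite add0n.
have lt_d i : i \in d -> ((q + p) <= i < n.-1)%N.
  move=> id_; rewrite (allP (block_word_ge _ _) _ id_).
  by have := allP (block_word_lt (q + p) g2_pos) _ id_; rewrite -sum_g addnA.
have lt_b i : i \in b -> (q <= i < (q + p).-1)%N by rewrite mem_iota; lia.
have la : letters a by apply/allP => i /lt_a; lia.
have lb : letters b by apply/allP => i /lt_b; lia.
have ld : letters d by apply/allP => i /lt_d; lia.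
have far_b : allrel far (d ++ a) b.
  by apply/allrelP => i j; rewrite mem_cat /far => /orP[/lt_d|/lt_a] + /lt_b; lia.
have odd_b : odd (size b) by rewrite size_iota; case: (p) p_pos even_p => //= r _; rewrite negbK.
have odd_da : odd (size (d ++ a)).
  move: odd_b L_even; rewrite -size_g size_cat size_iota !oddD => ->.
  by case: (odd (size a)); case: (odd (size d)).
have lda : letters (d ++ a) by rewrite all_cat ld.
have anti := xword_far lda lb far_b; rewrite odd_b odd_da /= in anti.
have Sda : S (xword (d ++ a) * xword b).
  apply: S_double; have := S_comm (G_xword (d ++ a)) (G_xword b).
  by rewrite -[xword b * _]opprK -anti opprK.
rewrite !big_cat /=; apply: S_trans (S_comm (G_xword a) (GM (G_xword b) (G_xword d))) _.
rewrite -mulrA -big_cat; apply: S_trans (S_comm (G_xword b) (G_xword (d ++ a))) _.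
exact: Sda.
Qed.

Lemma S_word_of_size w : (0 < n)%N -> letters w -> size w = L -> S (xword w).
Proof.
move=> n_gt0; apply: (@all_words n (fun w => size w = L -> S (xword w))) => //.
- move=> a b i j; rewrite all_cat /= => /and4P[_ lt_i lt_j _] far_ij IH size_w.
  have -> : xword (a ++ [:: i, j & b]) = - xword (a ++ [:: j, i & b]).
    by rewrite !big_cat !big_cons /= !mulrA -(mulrA _ (X i)) X_far // mulrN mulNr mulrA.
  by apply/SN/IH; rewrite -size_w !size_cat.
- move=> a b i; rewrite all_cat /= => /and4P[la lt_i lt_i1 lb] IH size_w.
  have -> : xword (a ++ [:: i.+1, i, i.+1 & b]) =
      xword (a ++ [:: i, i.+1, i & b]) - (v - 1) * (v - 1) * (xword (a ++ i.+1 :: b) - xword (a ++ i :: b)).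
    have Zs : Z ((v - 1) * (v - 1)) by apply: ZM; apply: ZB.
    have Zmul x y : (v - 1) * (v - 1) * (x * y) = x * ((v - 1) * (v - 1) * y).
      by rewrite mulrA (Z_comm _ Zs) -mulrA.
    rewrite !big_cat !big_cons /= -mulrBr Zmul -mulrBr; congr (_ * _).
    by rewrite -mulrBl [X in _ - X]mulrA -X_braid // mulrBl !mulrA opprB addrC subrK.
  apply: SB; first by apply: IH; rewrite -size_w !size_cat.
  move: L_even; rewrite -size_w size_cat /= => L_ev.
  apply: SZ; first by apply: ZM; apply: ZB.
  by apply: SB; apply: S_lower; rewrite -?size_w ?all_cat ?size_cat /= ?la ?lt_i ?lt_i1 //; lia.
- move=> a b i; rewrite all_cat /= => /and3P[la lt_i lb] size_w.
  have -> : xword (a ++ [:: i, i & b]) = - (v * v + 1) * xword (a ++ b).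
    have Zs : Z (- (v * v + 1)) by apply/ZN/ZD => //; apply: ZM.
    by rewrite !big_cat !big_cons /= (mulrA (X i)) X_sq // mulrA -(Z_comm _ Zs) mulrA.
  apply: SZ; first by apply/ZN/ZD => //; apply: ZM.
  move: L_even; rewrite -size_w size_cat /= => L_ev.
  by apply: S_lower; rewrite -?size_w ?all_cat ?size_cat /= ?la //; lia.
- move=> a b lw IH size_w; rewrite big_cat; apply: S_trans (S_comm (G_xword _) (G_xword _)) _.
  by rewrite -big_cat; apply: IH; rewrite size_cat addnC -size_cat.
move=> g g_pos sum_g size_g; case: (boolP (all odd g)) => [odd_g|not_odd].
  exact: S_odd_composition.
exact: S_even_part.
Qed.
End Level.

Hypothesis S_sorted : forall g, all odd g -> sumn g = n -> sorted geq g -> S (xword (block_word 0 g)).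

Lemma S_even_word w : (0 < n)%N -> letters w -> ~~ odd (size w) -> S (xword w).
Proof.
move=> n_gt0; have [m] := ubnP (size w); elim: m w => // m IHm w.
rewrite ltnS => le_wm lw even_w; apply: (@S_word_of_size (size w)) => // u lu even_u lt_uw.
by apply: IHm => //; apply: leq_trans le_wm.
Qed.
End Cocenter.

(** * The spin Hecke algebra *)

Section PresentedRelations.
Variables (K : fieldType) (F : lalgType K) (rel : F -> F -> Prop).
Local Notation P := (to_pres rel).

Lemma to_presN x : P (- x) = - P x.
Proof. by rewrite -scaleN1r to_presZ scaleN1r. Qed.

Lemma to_pres_rel l r : rel l r -> P l = P r.
Proof.
move=> lr; apply/eqP/to_pres_eq; rewrite -[_ - _]mulr1 -[_ - _]mul1r.
exact: rel_ideal_gen.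
Qed.

Lemma to_pres_square x a : rel (x * x) (a *: 1) -> P x * P x = a *: (1 : presented rel).
Proof. by move/to_pres_rel; rewrite to_presM to_presZ. Qed.

Lemma to_pres_anticomm x y : rel (x * y) (- (y * x)) -> P x * P y = - (P y * P x).
Proof. by move/to_pres_rel; rewrite to_presN !to_presM. Qed.

Lemma to_pres_braid x y a : rel (x * y * x - y * x * y) (a *: (y - x)) ->
  P x * P y * P x - P y * P x * P y = a *: (P y - P x).
Proof. by move/to_pres_rel; rewrite to_presZ !to_presD !to_presN !to_presM. Qed.

Lemma pres_scalerAr : (forall a (x y : F), x * (a *: y) = a *: (x * y)) ->
  forall a (x y : presented rel), x * (a *: y) = a *: (x * y).
Proof.
move=> F_scalerAr a x y; rewrite -(of_presK x) -(of_presK y).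
by rewrite -to_presZ -!to_presM -to_presZ F_scalerAr.
Qed.
End PresentedRelations.

Section SpinHeckeCocenter.
Variables (R : realType) (n : nat).
Local Notation K := (base_field R).
Local Notation H := (spin_hecke R n).
Local Notation v := (vv R).

(** A scalar acts on either side as multiplication by a constant. *)
Lemma free_alg_scalerAr (a : K) (x y : free_alg R n) : x * (a *: y) = a *: (x * y).
Proof.
have comm_a (z : free_alg R n) : a *: z = z * malgC a.
  rewrite malgM_def malgZ_def fgmulgU; apply: eq_bigr => m _.
  by rewrite mulm1 mulrC.
by rewrite !comm_a mulrA.
Qed.

Lemma spin_hecke_scalerAr (a : K) (x y : H) : x * (a *: y) = a *: (x * y).
Proof. exact/pres_scalerAr/free_alg_scalerAr. Qed.

Lemma spin_hecke_scalerAl (a : K) (x y : H) : (a *: x) * y = a *: (x * y).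
Proof. exact/esym/pres_scalerAl. Qed.

Lemma two_neq0 : (2 : K) != 0.
Proof.
have -> : (2 : K) = FracField.tofrac (2 : {poly R[i]}) by rewrite rmorph_nat.
by rewrite tofrac_eq0 -polyC_natr polyC_eq0 pnatr_eq0.
Qed.

Lemma vv_neq0 : v != 0.
Proof. by rewrite expf_neq0 // tofrac_eq0 polyX_eq0. Qed.

Lemma Rgen_sq (i : 'I_n.-1) : Rgen R i * Rgen R i = - (v ^+ 2 + 1) *: (1 : H).
Proof. exact/to_pres_square/rel_square. Qed.

Lemma Rgen_far (i j : 'I_n.-1) : far i j -> Rgen R i * Rgen R j = - (Rgen R j * Rgen R i).
Proof. by move=> far_ij; apply/to_pres_anticomm/rel_far. Qed.

Lemma Rgen_braid (i j : 'I_n.-1) : j = i.+1 :> nat ->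
  Rgen R i * Rgen R j * Rgen R i - Rgen R j * Rgen R i * Rgen R j
  = (v - 1) ^+ 2 *: (Rgen R j - Rgen R i).
Proof. by move=> def_j; apply/to_pres_braid/rel_braid. Qed.

Definition scalar_A (x : H) := exists2 a : K, in_A a & x = a *: (1 : H).
(** The value 1 out of range agrees with [composition_word], which drops the
    letters out of range. *)
Definition gen_letter (i : nat) : H := if insub i is Some j then Rgen R j else 1.
(** The A-module of the elements congruent to 0. *)
Definition odd_class (x : H) := span_A (fun y : H =>
  (exists h h', [/\ spin_hecke_A h, spin_hecke_A h' & (y : H) = h * h' - h' * h]) \/
  exists2 nu, nu \in odd_partitions n & y = Rword R (composition_word n (parts nu))) x.

Lemma scalar_mul a (x : H) : (a *: (1 : H)) * x = a *: x.
Proof. by rewrite spin_hecke_scalerAl mul1r. Qed.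

Lemma prod_gen_letter w : \prod_(i <- w) gen_letter i = Rword R (pmap insub w : seq 'I_n.-1).
Proof.
elim: w => [|i w IHw]; first by rewrite /Rword !big_nil.
rewrite big_cons IHw /Rword /gen_letter /=; case: insubP => [j _ _|_] /=; first by rewrite big_cons.
by rewrite mul1r.
Qed.

Lemma in_A0 : in_A (0 : K).
Proof. by rewrite -(subrr 1); apply: subring_genB; apply: subring_gen1. Qed.

Lemma in_AN (a : K) : in_A a -> in_A (- a).
Proof. by rewrite -sub0r; apply/subring_genB/in_A0. Qed.

Lemma in_AD (a b : K) : in_A a -> in_A b -> in_A (a + b).
Proof. by move=> Aa Ab; rewrite -[b]opprK; apply: subring_genB => //; apply: in_AN. Qed.

Lemma odd_composition_parts g : all odd g -> sumn g = n -> sorted geq g ->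
  exists2 nu, nu \in odd_partitions n & parts nu = g.
Proof.
move=> odd_g sum_g sorted_g.
have g_pos : all (leq 1) g by apply: sub_all odd_g => -[].
have size_g : (size g <= n)%N by rewrite -sum_g -(size_block_word 0 g_pos) leq_addl.
have le_g i : i \in g -> (i < n.+1)%N.
  by rewrite ltnS -sum_g; case/splitPr=> a b; rewrite sumn_cat /= addnCA leq_addr.
have size_s : (size (map (@inord n) g) <= n)%N by rewrite size_map.
have def_g : parts (Bseq size_s) = g.
  by rewrite /parts /= -map_comp map_id_in // => i /le_g lt_i; rewrite /= inordK.
by exists (Bseq size_s); rewrite ?inE def_g ?sorted_g ?odd_g ?sum_g /=.
Qed.

Lemma odd_class_Rword (w : seq 'I_n.-1) : (0 < n)%N -> ~~ odd (size w) -> odd_class (Rword R w).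
Proof.
move=> n_gt0 even_w.
have half_A : in_A (2^-1 : K) by apply: subring_gen_base; constructor.
have v_A : in_A v by apply: subring_gen_base; constructor 2.
have vinv_A : in_A v^-1 by apply: subring_gen_base; constructor 3.
have def_w : Rword R w = \prod_(i <- map val w) gen_letter i.
  rewrite prod_gen_letter; congr Rword; elim: (w) => //= i s <-; case: insubP => /= [j _ /val_inj -> //|].
  by rewrite ltn_ord.
have scA a : in_A a -> scalar_A (a *: (1 : H)) by exists a.
have gen_ord (i : 'I_n.-1) : gen_letter i = Rgen R i by rewrite /gen_letter valK.
rewrite def_w; apply: (@S_even_word H scalar_A (@spin_hecke_A R n) odd_class
  _ _ _ _ _ _ _ _ _ _ (2^-1 *: (1 : H)) _ _ n gen_letter (v *: (1 : H)) (v^-1 *: (1 : H))).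
- by move=> _ x [a _ ->]; rewrite scalar_mul spin_hecke_scalerAr mulr1.
- by exists 1; [apply: subring_gen1 | rewrite scale1r].
- by move=> _ _ [a Aa ->] [b Ab ->]; rewrite -scalerBl; apply/scA/subring_genB.
- by move=> _ _ [a Aa ->] [b Ab ->]; rewrite scalar_mul scalerA; apply/scA/subring_genM.
- by move=> _ [a Aa ->]; apply/spin_hecke_AZ/spin_hecke_A1.
- exact: spin_hecke_AD.
- exact: spin_hecke_AM.
- exact: span_AD.
- by move=> _ x [a Aa ->] Sx; rewrite scalar_mul; apply: span_AZ.
- by move=> x y Gx Gy; apply: span_A_base; left; exists x, y.
- exact: scA.
- by rewrite -scalerDl -mulr2n -[_ *+ 2]mulr_natl divff ?scale1r // two_neq0.
- exact: scA.
- exact: scA.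
- by rewrite scalar_mul scalerA divff ?scale1r // vv_neq0.
- by move=> i; rewrite /gen_letter; case: insub => [j|]; [apply: spin_hecke_A_gen | apply: spin_hecke_A1].
- move=> i lt_i; have := Rgen_sq (Ordinal lt_i); rewrite -gen_ord /= => ->.
  by rewrite scalar_mul scalerA scaleNr scalerDl scale1r expr2.
- move=> i j lt_i lt_j far_ij.
  by have := @Rgen_far (Ordinal lt_i) (Ordinal lt_j) far_ij; rewrite -!gen_ord.
- move=> i lt_i1; have lt_i := ltnW lt_i1.
  have := @Rgen_braid (Ordinal lt_i) (Ordinal lt_i1) erefl; rewrite -!gen_ord /= => ->.
  have -> : v *: (1 : H) - 1 = (v - 1) *: (1 : H) by rewrite scalerBl scale1r.
  by rewrite scalar_mul spin_hecke_scalerAl scalar_mul scalerA expr2.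
- move=> g odd_g sum_g sorted_g; have [nu nu_odd def_g] := odd_composition_parts odd_g sum_g sorted_g.
  apply: span_A_base; right; exists nu => //.
  by rewrite prod_gen_letter def_g.
- exact: n_gt0.
- by rewrite all_map; apply/allP => i _ /=.
by rewrite size_map.
Qed.

Lemma even_size_odd_partition nu : nu \in odd_partitions n ->
  ~~ odd (size (composition_word n (parts nu))).
Proof.
rewrite inE => /and3P[_ odd_nu /eqP sum_nu]; set g := parts nu in odd_nu sum_nu *.
have g_pos : all (leq 1) g by apply: sub_all odd_nu => -[].
rewrite -(size_map val) val_composition_word //.
elim: g {sum_nu g_pos} 0%N odd_nu => //= p g IHg k /andP[odd_p odd_g].
by rewrite size_cat size_iota oddD (negbTE (IHg _ odd_g)) addbF; case: p odd_p.
Qed.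

Lemma odd_class_combination (x : H) : odd_class x ->
  exists f : n.-bseq 'I_n.+1 -> K, (forall nu, nu \in odd_partitions n -> in_A (f nu)) /\
    commutator_A (x - \sum_(nu in odd_partitions n) f nu *: Rword R (composition_word n (parts nu))).
Proof.
elim=> [{}x [comm_x|[nu nu_odd ->]]||{}x y _ [f [Af fx]] _ [g [Ag gy]]|a {}x Aa _ [f [Af fx]]].
- exists (fun=> 0); split=> [mu _|]; first exact: in_A0.
  rewrite big1 => [|nu _]; last by rewrite scale0r.
  by rewrite subr0; apply: span_A_base.
- exists (fun mu => (mu == nu)%:R); split=> [mu _|].
    by case: (mu == nu); [exact: subring_gen1 | exact: in_A0].
  rewrite (bigD1 nu) //= eqxx scale1r big1 => [|mu /andP[_ /negbTE ->]]; last by rewrite scale0r.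
  by rewrite addr0 subrr; apply: span_A0.
- exists (fun=> 0); split=> [mu _|]; first exact: in_A0.
  rewrite big1 => [|nu _]; last by rewrite scale0r.
  by rewrite subr0; apply: span_A0.
- exists (fun nu => f nu + g nu); split=> [nu nu_odd|]; first exact: in_AD (Af _ nu_odd) (Ag _ nu_odd).
  rewrite (eq_bigr _ (fun nu _ => scalerDl _ _ _)) big_split /= opprD addrACA.
  exact: span_AD fx gy.
exists (fun nu => a * f nu); split=> [nu nu_odd|]; first exact: subring_genM (Af _ nu_odd).
rewrite (eq_bigr (fun nu => a *: (f nu *: Rword R (composition_word n (parts nu))))).
  by rewrite -scaler_sumr -scalerBr; exact: span_AZ Aa fx.
by move=> nu _; rewrite scalerA.
Qed.
End SpinHeckeCocenter.

Theorem theorem6p6 (R : realType) (n : nat) (hn : (1 <= n)%N)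
    (sigma : 'S_n) (w : seq 'I_n.-1)
    (hsigma : ~~ odd (coxeter_length sigma))
    (hw : reduced_expression w sigma) :
  exists f : n.-bseq 'I_n.+1 -> base_field R,
    (forall nu, nu \in odd_partitions n -> in_A (f nu)) /\
    even_commutator_A
      (Rword R w
       - \sum_(nu in odd_partitions n)
           f nu *: Rword R (composition_word n (parts nu))).
Proof.
have even_w : ~~ odd (size w) by rewrite hw.2.
have [f [Af comm_f]] := odd_class_combination (odd_class_Rword R hn even_w).
exists f; split=> //; split=> //; apply: span_AD.
  by apply: span_A_base; exists w.
rewrite -scaleN1r; apply: span_AZ; first exact/in_AN/subring_gen1.
elim/big_rec: _ => [|nu x nu_odd even_x]; first exact: span_A0.
apply: span_AD even_x; apply: span_AZ; first exact: Af.
by apply: span_A_base; exists (composition_word n (parts nu)) => //; apply: even_size_odd_partition.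
Qed.
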